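(* Let $\delta,r>0$ be fixed and let $([n_k],P_k,\pi_k)$, $k\in\mathbb N$, be a sequence of $(\delta,r)$-semi birth and death chains satisfying the product condition, i.e. $t_{\mathrm{rel}}^{(k)}=o(t_{\mathrm{mix}}^{(k)})$ as $k\to\infty$. Then the sequence exhibits a cutoff with a cutoff window $w_k:=\sqrt{t_{\mathrm{mix}}^{(k)}t_{\mathrm{rel}}^{(k)}}$.
   Context: Write $[n]=\{1,\dots,n\}$. For $n\in\mathbb N$ and $\delta,r>0$, a finite lazy reversible Markov chain $([n],P,\pi)$ (state space $[n]$, transition matrix $P$, stationary distribution $\pi$) is a $(\delta,r)$-semi birth and death (SBD) chain if (i) $P(i,j)=0$ for all $i,j\in[n]$ with $|i-j|>r$; (ii) $P(i,j)\ge\delta$ for all $i,j\in[n]$ with $|i-j|=1$. Lazy means $P(x,x)\ge1/2$ for all $x$; reversible means $\pi(x)P(x,y)=\pi(y)P(y,x)$. Chains have at least two states. For such a chain (time is discrete), with eigenvalues $1=\lambda_1>\lambda_2\ge\dots\ge 0$ of $P$, $t_{\mathrm{rel}}:=(1-\lambda_2)^{-1}$. Let $d(t):=\max_{x}\|P^t(x,\cdot)-\pi\|_{\mathrm{TV}}$, $t_{\mathrm{mix}}(\epsilon):=\inf\{t\ge 0: d(t)\le\epsilon\}$, $t_{\mathrm{mix}}:=t_{\mathrm{mix}}(1/4)$. A superscript $(k)$ denotes the quantity for the $k$-th chain. A sequence of chains exhibits a cutoff if $\lim_{k\to\infty}t_{\mathrm{mix}}^{(k)}(\epsilon)/t_{\mathrm{mix}}^{(k)}(1-\epsilon)=1$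 for every $0<\epsilon<1$. It has a cutoff window $w_k$ if $w_k=o(t_{\mathrm{mix}}^{(k)})$ and for every $\epsilon\in(0,1)$ there is $c_\epsilon>0$ such that $t_{\mathrm{mix}}^{(k)}(\epsilon)-t_{\mathrm{mix}}^{(k)}(1-\epsilon)\le c_\epsilon w_k$ for all $k$. *)

(* Defs.v *)
From HB Require Import structures.
From mathcomp Require Import all_boot all_order all_algebra.
From mathcomp Require Import all_classical all_reals all_analysis.
Set Implicit Arguments.
Unset Strict Implicit.
Unset Printing Implicit Defensive.
Import Order.TTheory GRing.Theory Num.Theory.
Import numFieldNormedType.Exports.
Local Open Scope classical_set_scope.
Local Open Scope ring_scope.

Definition stochastic (R : realType) (n : nat) (P : 'M[R]_n) : Prop :=
  (forall x y, 0 <= P x y) /\ (forall x, \sum_y P x y = 1).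

Definition is_distribution (R : realType) (n : nat) (mu : 'rV[R]_n) : Prop :=
  (forall x, 0 <= mu 0 x) /\ \sum_x mu 0 x = 1.

Definition stationary (R : realType) (n : nat) (P : 'M[R]_n) (pi : 'rV[R]_n)
  : Prop := is_distribution pi /\ pi *m P = pi.

Definition is_lazy (R : realType) (n : nat) (P : 'M[R]_n) : Prop :=
  forall x, 2^-1 <= P x x.

Definition reversible (R : realType) (n : nat) (P : 'M[R]_n) (pi : 'rV[R]_n)
  : Prop := forall x y, pi 0 x * P x y = pi 0 y * P y x.

(* The state i of [n] = {1, ..., n} is represented by the ordinal i - 1 of
   'I_n, which leaves the distances |i - j| unchanged. The range r is a real
   number. *)
Definition SBD_chain (R : realType) (delta r : R) (n : nat) (P : 'M[R]_n)
    (pi : 'rV[R]_n) : Prop :=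
  [/\ (1 < n)%N, stochastic P, stationary P pi, is_lazy P & reversible P pi] /\
  (forall i j : 'I_n, r < `|i%:R - j%:R : R| -> P i j = 0) /\
  (forall i j : 'I_n, `|i%:R - j%:R : R| = 1 -> delta <= P i j).

(* Largest eigenvalue other than 1. As 1 is a simple eigenvalue of an
   irreducible chain, this is the second term of the list of eigenvalues
   1 = lambda_1 > lambda_2 >= ... counted with multiplicity. *)
Definition lambda2 (R : realType) (n : nat) (P : 'M[R]_n) : R :=
  sup [set a : R | eigenvalue P a /\ a != 1].

Definition trel (R : realType) (n : nat) (P : 'M[R]_n) : R :=
  (1 - lambda2 P)^-1.

Definition tv_dist (R : realType) (n : nat) (mu nu : 'rV[R]_n) : R :=
  2^-1 * \sum_x `|mu 0 x - nu 0 x|.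

Definition tv_max (R : realType) (n : nat) (P : 'M[R]_n) (pi : 'rV[R]_n)
    (t : nat) : R :=
  \big[Num.max/0]_(x < n) tv_dist (row x (P ^+ t)) pi.

Definition tmix (R : realType) (n : nat) (P : 'M[R]_n) (pi : 'rV[R]_n)
    (eps : R) : R :=
  inf [set t%:R | t in [set t : nat | tv_max P pi t <= eps]].

(* A sequence of chains is given by sizes n k, transition matrices P k and
   stationary distributions pi k. The bare mixing time is tmix at 1/4. *)
Definition product_condition (R : realType) (n : nat -> nat)
    (P : forall k, 'M[R]_(n k)) (pi : forall k, 'rV[R]_(n k)) : Prop :=
  (fun k => trel (P k)) =o_\oo (fun k => tmix (P k) (pi k) 4^-1).

Definition exhibits_cutoff (R : realType) (n : nat -> nat)
    (P : forall k, 'M[R]_(n k)) (pi : forall k, 'rV[R]_(n k)) : Prop :=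
  forall eps : R, 0 < eps < 1 ->
    (fun k => tmix (P k) (pi k) eps / tmix (P k) (pi k) (1 - eps))
      @ \oo --> (1 : R).

Definition has_cutoff_window (R : realType) (n : nat -> nat)
    (P : forall k, 'M[R]_(n k)) (pi : forall k, 'rV[R]_(n k)) (w : nat -> R)
  : Prop :=
  w =o_\oo (fun k => tmix (P k) (pi k) 4^-1) /\
  forall eps : R, 0 < eps < 1 -> exists2 c : R, 0 < c &
    forall k, tmix (P k) (pi k) eps - tmix (P k) (pi k) (1 - eps) <= c * w k.

(* Main.v *)
(* For a half-line L of mass at least 1/3, let u(x) be the mean hitting time of
   L.  Killed on L, the chain has gap of order 1/trel, and a walk that enters
   the r states next to a level has probability at least delta^r to visit any
   given one of them; hence the time spent below a level j after it was first
   passed, and the oscillation of u on an interval of length r, are both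
   O(trel).  So u decreases along the levels up to O(trel), which yields
   Var_x(T_L) = O(trel sup u) = O(trel tmix) and, by Chebyshev's inequality,
   concentration of T_L in a window of order sqrt(trel tmix).

   Upper bound on the mixing time: for a set A, all states outside a set of
   small mass satisfy P^s(y, A) - pi(A) <= eps simultaneously for all
   s >= C trel.  If that mass is small enough, some r consecutive states in the
   bulk are of this kind, and a walk cannot jump over them, so that it is mixed
   C trel steps after hitting a half-line.  Lower bound: before hitting L, the
   walk spends all but a time O(trel) in a set of small mass. *)
Require Import Defs.
From mathcomp Require Import all_boot all_order all_algebra.
From mathcomp Require Import all_classical all_reals all_analysis.
From mathcomp Require Import zify ring lra.
Set Implicit Arguments.
Unset Strict Implicit.
Unset Printing Implicit Defensive.
Import Order.TTheory GRing.Theory Num.Theory.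
Import numFieldNormedType.Exports.
Local Open Scope ring_scope.

(** * Reversible lazy chains *)

(** With jumps of length up to [r], a passage time is not a sum of independent nearest-neighbour
    passage times and the mean hitting time need not be monotone along the line; every exact birth
    and death formula is therefore replaced by an inequality with an error O(trel). The walk reaches
    the mixed states at a random time, so these must be mixed at all later times at once: this is
    what a maximal inequality is needed for. They also depend on the event [A], so the hitting
    estimates are proved for every half-line of mass at least 1/3, in both orientations. No path
    space is built. Means solve linear equations, tails are defined by recursion, and the minimum
    principle and inductions on time stand in for the Markov property. Nor is [P] diagonalised: the
    spectral estimates come from the sequence <P^j f, f> being nonnegative, nonincreasing and
    convex. *)

Lemma discriminant_le (R : realFieldType) (a b c : R) :
  (forall t, 0 <= a + 2 * t * b + t ^+ 2 * c) -> b ^+ 2 <= a * c.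
Proof.
move=> q.
have a0 : 0 <= a by have := q 0; rewrite expr0n /= !mulr0 !mul0r !addr0.
have [c0|c0] := eqVneq c 0.
  have [->|b0] := eqVneq b 0; first by rewrite c0 mulr0 expr0n.
  have := q (- (a + 1) / (2 * b)).
  rewrite c0 mulr0 addr0.
  have -> : a + 2 * (- (a + 1) / (2 * b)) * b = -1 by field.
  lra.
(* Nothing is assumed on the sign of [c]; a negative one is excluded by evaluating the quadratic far
   out, on the side given by the sign of [b]. *)
have cp : 0 < c.
  rewrite lt_def c0 /= leNgt; apply/negP => cn.
  have := q (b / - c + (a + 1) / - c + 1).
  have [b1|b1] := lerP 0 b.
    have := q ((a + 1 + 2 * b) / - c + 1).
    set s := (a + 1 + 2 * b) / - c.
    have es : s * c = - (a + 1 + 2 * b).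
      rewrite /s mulrAC -mulrA; have -> : c / - c = -1 by field.
      by rewrite mulrN1.
    have s0 : 0 <= s by rewrite /s divr_ge0//; lra.
    have -> : (s + 1) ^+ 2 * c = (s + 1) * (s * c + c) by ring.
    rewrite es; nra.
  have := q (- ((a + 1 - 2 * b) / - c + 1)).
  set s := (a + 1 - 2 * b) / - c.
  have es : s * c = - (a + 1 - 2 * b).
    rewrite /s mulrAC -mulrA; have -> : c / - c = -1 by field.
    by rewrite mulrN1.
  have s0 : 0 <= s by rewrite /s divr_ge0//; lra.
  have -> : (- (s + 1)) ^+ 2 * c = (s + 1) * (s * c + c) by ring.
  rewrite es; nra.
have := q (- b / c).
have -> : a + 2 * (- b / c) * b + (- b / c) ^+ 2 * c = (a * c - b ^+ 2) / c by field.
by rewrite pmulr_lge0 ?invr_gt0// subr_ge0.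
Qed.

Section Reversible.
Variables (R : realFieldType) (n : nat) (P : 'M[R]_n) (p : 'I_n -> R).
Implicit Types f g h : 'I_n -> R.

Definition op f : 'I_n -> R := fun x => \sum_y P x y * f y.

Definition ip f g : R := \sum_x p x * (f x * g x).

Lemma ipC f g : ip f g = ip g f.
Proof. by apply: eq_bigr => x _; rewrite (mulrC (f x)). Qed.

Lemma ip_comb (a b : R) f g h :
  ip (fun x => a * f x + b * g x) h = a * ip f h + b * ip g h.
Proof.
rewrite /ip !mulr_sumr -big_split; apply: eq_bigr => x _ /=; ring.
Qed.

Lemma ipBl f g h : ip (fun x => f x - g x) h = ip f h - ip g h.
Proof.
have -> : (fun x => f x - g x) = (fun x => 1 * f x + (-1) * g x).
  by apply/funext => x; ring.
by rewrite ip_comb; ring.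
Qed.

Lemma ipBr f g h : ip h (fun x => f x - g x) = ip h f - ip h g.
Proof. by rewrite ipC ipBl !(ipC h). Qed.

Lemma op_comb (a b : R) f g :
  op (fun x => a * f x + b * g x) = (fun x => a * op f x + b * op g x).
Proof.
apply/funext => x; rewrite /op !mulr_sumr -big_split.
by apply: eq_bigr => y _ /=; ring.
Qed.

Lemma opB f g : op (fun x => f x - g x) = (fun x => op f x - op g x).
Proof.
have -> : (fun x => f x - g x) = (fun x => 1 * f x + (-1) * g x).
  by apply/funext => x; ring.
by rewrite op_comb; apply/funext => x; ring.
Qed.

Lemma iter_opB f g t : iter t op (fun x => f x - g x) =
  (fun x => iter t op f x - iter t op g x).
Proof. by elim: t => //= t ->; rewrite opB. Qed.

Hypothesis P0 : forall x y, 0 <= P x y.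
Hypothesis P1 : forall x, \sum_y P x y = 1.
Hypothesis p0 : forall x, 0 <= p x.
Hypothesis rev : forall x y, p x * P x y = p y * P y x.
Hypothesis lazy : forall x, 2^-1 <= P x x.

Lemma op_le f g : (forall x, f x <= g x) -> forall x, op f x <= op g x.
Proof. by move=> fg x; apply: ler_sum => y _; rewrite ler_wpM2l. Qed.

Lemma op_cst (c : R) : op (fun=> c) = fun=> c.
Proof. by apply/funext => x; rewrite /op -mulr_suml P1 mul1r. Qed.

Lemma iter_op_cst (c : R) t : iter t op (fun=> c) = fun=> c.
Proof. by elim: t => //= t ->; rewrite op_cst. Qed.

Lemma ip_ge0 f : 0 <= ip f f.
Proof. by apply: sumr_ge0 => x _; rewrite mulr_ge0// -expr2 sqr_ge0. Qed.

Lemma ip_op f g : ip (op f) g = ip f (op g).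
Proof.
rewrite /ip /op.
under eq_bigr do rewrite mulr_suml mulr_sumr.
under [RHS]eq_bigr do rewrite mulrCA mulr_sumr mulr_sumr.
rewrite exchange_big /=; apply: eq_bigr => x _; apply: eq_bigr => y _.
transitivity (p y * P y x * (f x * g y)); first by ring.
by rewrite rev; ring.
Qed.

Lemma ip_opE f : ip (op f) f = \sum_x \sum_y p x * P x y * (f x * f y).
Proof.
apply: eq_bigr => x _; rewrite /op mulr_suml mulr_sumr.
by apply: eq_bigr => y _; ring.
Qed.

Lemma sum_pP_l f : \sum_x \sum_y p x * P x y * f x = \sum_x p x * f x.
Proof.
apply: eq_bigr => x _; rewrite -mulr_suml; congr (_ * _).
by rewrite -mulr_sumr P1 mulr1.
Qed.

Lemma sum_pP_r f : \sum_x \sum_y p x * P x y * f y = \sum_x p x * f x.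
Proof.
rewrite exchange_big -[RHS]sum_pP_l /=.
by apply: eq_bigr => x _; apply: eq_bigr => y _; rewrite rev.
Qed.

Lemma dirichletE f :
  \sum_x \sum_y p x * P x y * (f x - f y) ^+ 2 = 2 * (ip f f - ip (op f) f).
Proof.
transitivity (\sum_x \sum_y (p x * P x y * (f x ^+ 2) + p x * P x y * (f y ^+ 2)
    - 2 * (p x * P x y * (f x * f y)))).
  by apply: eq_bigr => x _; apply: eq_bigr => y _; ring.
under eq_bigr do rewrite sumrB big_split /= -mulr_sumr.
rewrite sumrB big_split /= -mulr_sumr -ip_opE.
rewrite (sum_pP_l (fun x => f x ^+ 2)) (sum_pP_r (fun x => f x ^+ 2)) /ip.
under eq_bigr do rewrite expr2.
ring.
Qed.

Lemma ip_op_le f : ip (op f) f <= ip f f.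
Proof.
rewrite -subr_ge0 -(pmulr_rge0 _ (ltr0Sn R 1)) -dirichletE.
apply: sumr_ge0 => x _; apply: sumr_ge0 => y _.
by rewrite mulr_ge0 ?sqr_ge0// mulr_ge0.
Qed.

(** Laziness makes [P] positive semidefinite: in the sum of p(x) P(x,y) (f(x) + f(y))^2, which
    equals 2 (<f,f> + <Pf,f>), the diagonal terms alone are at least 2 <f,f>. *)
Lemma ip_op_ge0 f : 0 <= ip (op f) f.
Proof.
have diag : 2 * ip f f <= \sum_x \sum_y p x * P x y * (f x + f y) ^+ 2.
  rewrite /ip mulr_sumr; apply: ler_sum => x _.
  rewrite (bigD1 x)//=; apply: le_trans (_ : p x * P x x * (f x + f x) ^+ 2 <= _).
    have h : 0 <= p x * f x ^+ 2 * (P x x - 2^-1).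
      apply: mulr_ge0; last by rewrite subr_ge0.
      by rewrite mulr_ge0 ?sqr_ge0.
    rewrite -subr_ge0; suff -> : p x * P x x * (f x + f x) ^+ 2 -
      2 * (p x * (f x * f x)) = 4 * (p x * f x ^+ 2 * (P x x - 2^-1)).
      by rewrite mulr_ge0.
    by field.
  rewrite lerDl; apply: sumr_ge0 => y _.
  by rewrite mulr_ge0 ?sqr_ge0// mulr_ge0.
have := diag.
have -> : \sum_x \sum_y p x * P x y * (f x + f y) ^+ 2 =
    2 * (ip f f + ip (op f) f).
  transitivity (\sum_x \sum_y (p x * P x y * (f x ^+ 2) + p x * P x y * (f y ^+ 2)
      + 2 * (p x * P x y * (f x * f y)))).
    by apply: eq_bigr => x _; apply: eq_bigr => y _; ring.
  under eq_bigr do rewrite big_split big_split /= -mulr_sumr.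
  rewrite big_split big_split /= -mulr_sumr -ip_opE.
  rewrite (sum_pP_l (fun x => f x ^+ 2)) (sum_pP_r (fun x => f x ^+ 2)) /ip.
  under eq_bigr do rewrite expr2.
  ring.
lra.
Qed.

Lemma ip_quadratic f g t :
  ip (fun x => 1 * f x + t * g x) (fun x => 1 * f x + t * g x) =
  ip f f + 2 * t * ip f g + t ^+ 2 * ip g g.
Proof.
by rewrite ip_comb (ipC f) (ipC g) !ip_comb (ipC g f); ring.
Qed.

Lemma ip_op_quadratic f g t :
  ip (op (fun x => 1 * f x + t * g x)) (fun x => 1 * f x + t * g x) =
  ip (op f) f + 2 * t * ip (op f) g + t ^+ 2 * ip (op g) g.
Proof.
rewrite op_comb ip_comb (ipC (op f)) (ipC (op g)) !ip_comb.
by rewrite (ipC f) (ipC g) (ipC f) (ip_op g f) (ipC g (op f)) (ipC g (op g)); ring.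
Qed.

Lemma ip_CS f g : ip f g ^+ 2 <= ip f f * ip g g.
Proof.
apply: discriminant_le => t.
by have := ip_ge0 (fun x => 1 * f x + t * g x); rewrite ip_quadratic; lra.
Qed.

Lemma ip_op_CS f g : ip (op f) g ^+ 2 <= ip (op f) f * ip (op g) g.
Proof.
apply: discriminant_le => t.
by have := ip_op_ge0 (fun x => 1 * f x + t * g x); rewrite ip_op_quadratic; lra.
Qed.

(** Cauchy-Schwarz for the semidefinite form <P., .> at [f] and [op f], followed by division by the
    squared norm of [op f]; it replaces the spectral theorem. *)
Lemma sqr_op_le (lam : R) f : 0 <= lam ->
  ip (op (op f)) (op f) <= lam * ip (op f) (op f) ->
  ip (op f) (op f) <= lam * ip (op f) f.
Proof.
move=> lam0 gap; have cs := ip_op_CS f (op f); have := ip_ge0 (op f).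
rewrite le0r => /predU1P[->|pos]; first by rewrite mulr_ge0 ?ip_op_ge0.
rewrite -(ler_pM2r pos) -expr2; apply: le_trans cs _.
by rewrite (mulrC lam) -mulrA ler_wpM2l// ip_op_ge0.
Qed.

Lemma sqr_op_le_op f : ip (op f) (op f) <= ip (op f) f.
Proof. by rewrite -[leRHS]mul1r; apply: sqr_op_le; rewrite ?mul1r ?ip_op_le. Qed.

(** The moments of the spectral measure of [f]. Even indices give a squared norm and odd ones a
    value of the form <P., .>, hence the case distinctions on parity below. *)
Definition corr f j := ip (iter j op f) f.

Lemma ip_iter f g i : ip (iter i op f) g = ip f (iter i op g).
Proof. by elim: i f g => // i IH f g; rewrite iterS ip_op IH -iterSr. Qed.

Lemma corr_double f i : corr f i.*2 = ip (iter i op f) (iter i op f).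
Proof. by rewrite /corr -addnn iterD ip_iter. Qed.

Lemma corr_doubleS f i :
  corr f i.*2.+1 = ip (op (iter i op f)) (iter i op f).
Proof. by rewrite /corr -addnn -addnS iterD ip_iter ip_op -iterS ipC ip_op ipC. Qed.

Lemma corr_ge0 f j : 0 <= corr f j.
Proof.
rewrite -(odd_double_half j); case: (odd j) => /=.
  by rewrite add1n corr_doubleS ip_op_ge0.
by rewrite add0n corr_double ip_ge0.
Qed.

Lemma corr_le f j : corr f j.+1 <= corr f j.
Proof.
rewrite -(odd_double_half j); case: (odd j) => /=.
  by rewrite add1n -doubleS corr_double corr_doubleS iterS sqr_op_le_op.
by rewrite add0n corr_double corr_doubleS ip_op_le.
Qed.

(** The second difference of the moments of [f] is a moment of [f - op f]; with [corr_ge0] this is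
    their convexity. *)
Lemma corr_diff f j :
  corr (fun x => f x - op f x) j =
  corr f j - corr f j.+1 - (corr f j.+1 - corr f j.+2).
Proof.
rewrite /corr iter_opB -!iterSr !ipBl !ipBr.
by rewrite -!ip_op -!iterS; ring.
Qed.

Lemma sum_corr_diff f m k :
  \sum_(m <= j < m + k) (corr f j - corr f j.+1) = corr f m - corr f (m + k).
Proof.
elim: k => [|k IH]; first by rewrite addn0 big_geq ?subrr.
by rewrite addnS big_nat_recr ?leq_addr//= IH; ring.
Qed.

Lemma antitone_sum_ge (d : nat -> R) m k :
  (forall i, d i.+1 <= d i) -> k.+1%:R * d (m + k)%N <= \sum_(m <= i < m + k.+1) d i.
Proof.
move=> anti; rewrite mulr_natl.
have -> : d (m + k)%N *+ k.+1 = \sum_(m <= i < m + k.+1) d (m + k)%N.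
  by rewrite sumr_const_nat addKn.
rewrite big_nat [leRHS]big_nat; apply: ler_sum => i /andP[_ ik].
rewrite addnS ltnS in ik; rewrite -(subnKC ik); elim: (_ - _)%N => [|q IH].
  by rewrite addn0.
by rewrite addnS; apply: le_trans (anti _) IH.
Qed.

Lemma corr_diff_bound f j : j.+1%:R * (corr f j - corr f j.+1) <= ip f f.
Proof.
apply: le_trans (antitone_sum_ge (d := fun i => corr f i - corr f i.+1) 0 j _) _.
  by move=> i; rewrite -subr_ge0 -corr_diff corr_ge0.
by rewrite sum_corr_diff lerBlDr lerDl corr_ge0.
Qed.

(** One factor [s.+1] comes from averaging the antitone second differences over s, ..., 2s, whose
    sum telescopes to at most a first difference at [s]; the other comes from the decay of first
    differences in [corr_diff_bound]. *)
Lemma increment_bound f s :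
  s.+1%:R ^+ 2 * ip (fun x => iter s op f x - iter s.+1 op f x)
                    (fun x => iter s op f x - iter s.+1 op f x) <= ip f f.
Proof.
pose k := fun x => f x - op f x.
have -> : (fun x => iter s op f x - iter s.+1 op f x) = iter s op k.
  by rewrite /k iter_opB iterSr.
rewrite -corr_double; apply: le_trans (corr_diff_bound f s).
rewrite expr2 -mulrA ler_wpM2l//.
apply: le_trans (_ : corr f s - corr f s.+1 -
   (corr f (s + s.+1)%N - corr f (s + s.+1).+1) <= _); last first.
  by rewrite lerBlDr lerDl subr_ge0 corr_le.
rewrite -addnn; apply: le_trans (antitone_sum_ge _ _ (corr_le k)) _.
suff tele q : \sum_(s <= i < s + q) corr k i =
  corr f s - corr f s.+1 - (corr f (s + q)%N - corr f (s + q).+1) by rewrite tele.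
elim: q => [|q IH]; first by rewrite addn0 big_geq ?subrr.
by rewrite addnS big_nat_recr ?leq_addr//= IH corr_diff; ring.
Qed.

(** * Decay under a spectral gap, and the maximal inequality *)

Variable lam : R.
Hypothesis lam0 : 0 <= lam.
Hypothesis lam1 : lam < 1.
Hypothesis gap : forall f, \sum_x p x * f x = 0 -> ip (op f) f <= lam * ip f f.

Lemma mean_op f : \sum_x p x * op f x = \sum_x p x * f x.
Proof.
rewrite -(sum_pP_r f); apply: eq_bigr => x _; rewrite mulr_sumr.
by apply: eq_bigr => y _; rewrite mulrA.
Qed.

Lemma mean_iter f t : \sum_x p x * iter t op f x = \sum_x p x * f x.
Proof. by elim: t => //= t IH; rewrite mean_op. Qed.

Lemma decay f t : \sum_x p x * f x = 0 ->
  ip (iter t op f) (iter t op f) <= (lam ^+ t) ^+ 2 * ip f f.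
Proof.
move=> f0; elim: t => [|t IH]; first by rewrite !expr1n mul1r.
rewrite iterS; set g := iter t op f.
have g0 : \sum_x p x * g x = 0 by rewrite mean_iter.
apply: le_trans (_ : lam * (lam * ip g g) <= _).
  apply: (le_trans (sqr_op_le lam0 _)); first by apply: gap; rewrite mean_op.
  by rewrite ler_wpM2l// gap.
apply: le_trans (_ : lam * (lam * ((lam ^+ t) ^+ 2 * ip f f)) <= _).
  by rewrite !ler_wpM2l.
by rewrite [lam ^+ t.+1]exprS le_eqVlt; apply/orP; left; apply/eqP; ring.
Qed.

Lemma geometric_le k : (1 - lam) * \sum_(0 <= i < k) lam ^+ i <= 1.
Proof.
have -> : (1 - lam) * \sum_(0 <= i < k) lam ^+ i = 1 - lam ^+ k.
  elim: k => [|k IH]; first by rewrite big_geq// mulr0 expr0 subrr.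
  by rewrite big_nat_recr//= mulrDr IH exprS; ring.
by rewrite lerBlDr lerDl exprn_ge0.
Qed.

Lemma lam_exp_le s : (1 - lam) * s%:R * lam ^+ s <= 1.
Proof.
apply: le_trans (geometric_le s); rewrite -mulrA ler_wpM2l ?subr_ge0 ?(ltW lam1)//.
case: s => [|s]; first by rewrite mul0r big_geq.
apply: le_trans (_ : s.+1%:R * lam ^+ (0 + s) <= _).
  by rewrite add0n ler_wpM2l// exprS ler_piMl ?exprn_ge0 ?(ltW lam1).
apply: (antitone_sum_ge (d := fun i => lam ^+ i) 0) => i.
by rewrite exprS ler_piMl ?exprn_ge0 ?(ltW lam1).
Qed.

(* Replaces Starr's maximal inequality: |f_i - f_(i+1)| has norm at most
   |f| / (i + 1), since (1 - x) x^i <= 1 / (i + 1) on the spectrum, so the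
   variation of f_s^2 over s >= s0 is summable with a total of order
   trel / s0. *)
Lemma maximal_ineq f s0 k (th : R) (B : pred 'I_n) :
  \sum_x p x * f x = 0 -> ip f f <= 1 -> (0 < s0)%N ->
  (forall x, B x -> exists s, [/\ (s0 <= s)%N, (s <= s0 + k)%N &
     th <= iter s op f x ^+ 2]) ->
  th * (\sum_(x | B x) p x) <= 3 / (s0%:R * (1 - lam)).
Proof.
move=> f0 f1 s0p hB.
pose F i := iter i op f.
pose v i x := `|F i x - F i.+1 x| * `|F i x + F i.+1 x|.
have pt x s : (s0 <= s)%N -> (s <= s0 + k)%N ->
    F s x ^+ 2 <= F s0 x ^+ 2 + \sum_(s0 <= i < s0 + k) v i x.
  move=> s1 s2; rewrite (big_cat_nat s1 s2)/= addrA.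
  rewrite -[leLHS]addr0 lerD//; last first.
    by apply: sumr_ge0 => i _; rewrite mulr_ge0.
  rewrite -(subnKC s1); elim: (s - s0)%N => [|q IH].
    by rewrite addn0 big_geq// addr0.
  rewrite addnS big_nat_recr ?leq_addr//= addrA -lerBlDr.
  apply: le_trans IH; rewrite lerBlDr -lerBlDl.
  apply: le_trans (ler_norm _) _; rewrite distrC /v -normrM -subr_sqr.
  by [].
(* Cauchy-Schwarz: the difference has norm at most 1/(i+1) by [increment_bound], the sum has norm at
   most 2 lam^i by [decay]. *)
have vnorm i : \sum_x p x * v i x <= 2 * lam ^+ i / i.+1%:R.
  have i0 : 0 < i.+1%:R :> R by rewrite ltr0Sn.
  pose a x := `|F i x - F i.+1 x|; pose b x := `|F i x + F i.+1 x|.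
  have -> : \sum_x p x * v i x = ip a b by [].
  have L0 : 0 <= lam ^+ i by rewrite exprn_ge0.
  have ab : ip a a * ip b b <= (2 * lam ^+ i / i.+1%:R) ^+ 2.
    have ha : ip a a <= i.+1%:R ^- 2.
      have -> : ip a a = ip (fun x => F i x - F i.+1 x) (fun x => F i x - F i.+1 x).
        by apply: eq_bigr => x _; rewrite -!expr2 /a real_normK ?num_real.
      rewrite -[leRHS]mul1r ler_pdivlMr ?exprn_gt0// mulrC.
      exact: le_trans (increment_bound f i) f1.
    have hb : ip b b <= 4 * (lam ^+ i) ^+ 2.
      apply: le_trans (_ : 2 * ip (F i) (F i) + 2 * ip (F i.+1) (F i.+1) <= _).
        rewrite /ip !mulr_sumr -big_split; apply: ler_sum => x _ /=.
        rewrite -!expr2 /b real_normK ?num_real//.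
        have := mulr_ge0 (p0 x) (sqr_ge0 (F i x - F i.+1 x)).
        rewrite -[F i.+1 x]/(op (F i) x) => h; rewrite -subr_ge0; move: h.
        by congr (0 <= _); ring.
      have l1 : lam ^+ i.+1 <= lam ^+ i by rewrite exprS ler_piMl ?exprn_ge0 ?(ltW lam1).
      have := decay i f0; have := decay i.+1 f0.
      rewrite -/(F i) -/(F i.+1) => h1 h2.
      have : (lam ^+ i.+1) ^+ 2 <= (lam ^+ i) ^+ 2.
        by rewrite ler_pXn2r// nnegrE ?exprn_ge0.
      have q0 := sqr_ge0 (lam ^+ i); have q1 := sqr_ge0 (lam ^+ i.+1).
      move: h1 h2; set q := _ ^+ 2; set q' := (lam ^+ i) ^+ 2 => h1 h2 h3.
      have : q * ip f f <= q' * 1 by apply: ler_pM => //; exact: ip_ge0.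
      have : q' * ip f f <= q' * 1 by rewrite ler_wpM2l.
      lra.
    apply: le_trans (_ : i.+1%:R ^- 2 * (4 * (lam ^+ i) ^+ 2) <= _).
      by rewrite ler_pM// ip_ge0.
    by rewrite le_eqVlt; apply/orP; left; apply/eqP; rewrite !exprMn exprVn; ring.
  have := le_trans (ip_CS a b) ab.
  have r0 : 0 <= 2 * lam ^+ i / i.+1%:R by rewrite divr_ge0// ?mulr_ge0// ltW.
  have l0 : 0 <= ip a b.
    by apply: sumr_ge0 => x _; rewrite mulr_ge0// mulr_ge0 ?normr_ge0.
  by rewrite ler_pXn2r// nnegrE.
have g1 : 0 < 1 - lam by rewrite subr_gt0.
have s0r : 0 < s0%:R :> R by rewrite ltr0n.
have L : th * (\sum_(x | B x) p x) <=
    ip (F s0) (F s0) + \sum_(s0 <= i < s0 + k) \sum_x p x * v i x.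
  rewrite exchange_big /ip -big_split /= mulr_sumr.
  rewrite [leRHS](bigID B)/= -[leLHS]addr0 lerD//; last first.
    apply: sumr_ge0 => x _; rewrite addr_ge0//.
      by rewrite mulr_ge0// -expr2 sqr_ge0.
    by apply: sumr_ge0 => i _; rewrite !mulr_ge0 ?normr_ge0.
  apply: ler_sum => x Bx; have [s [s1 s2 hs]] := hB x Bx.
  rewrite -mulr_sumr -mulrDr mulrC ler_wpM2l// -expr2.
  exact: le_trans hs (pt _ _ s1 s2).
apply: le_trans L _.
have e1 : ip (F s0) (F s0) <= 1 / (s0%:R * (1 - lam)).
  apply: le_trans (decay s0 f0) _.
  apply: le_trans (_ : (lam ^+ s0) ^+ 2 * 1 <= _).
    by rewrite ler_wpM2l// sqr_ge0.
  rewrite mulr1 expr2 ler_pdivlMr ?mulr_gt0//.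
  apply: le_trans (_ : lam ^+ s0 * 1 <= _); last first.
    by rewrite mulr1 exprn_ile1// ltW.
  rewrite -mulrA ler_wpM2l ?exprn_ge0//; apply: le_trans (lam_exp_le s0).
  by rewrite le_eqVlt; apply/orP; left; apply/eqP; ring.
(* The factor 1/(i+1) is frozen at 1/s0 and the geometric series supplies 1/(1 - lam), so the bound
   does not depend on the length [k] of the time interval. *)
have e2 : \sum_(s0 <= i < s0 + k) \sum_x p x * v i x <= 2 / (s0%:R * (1 - lam)).
  apply: le_trans (_ : \sum_(s0 <= i < s0 + k) 2 / s0%:R * lam ^+ i <= _).
    rewrite big_nat [leRHS]big_nat; apply: ler_sum => i /andP[i0 _].
    apply: le_trans (vnorm i) _.
    rewrite mulrAC ler_wpM2r ?exprn_ge0// ler_wpM2l//.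
    by rewrite lef_pV2 ?posrE ?ltr0Sn// ler_nat (leq_trans i0).
  rewrite -mulr_sumr invfM mulrA; apply: ler_wpM2l; first by rewrite divr_ge0// ltW.
  rewrite -[leRHS]mul1r ler_pdivlMr// mulrC; apply: le_trans (geometric_le (s0 + k)).
  apply: ler_wpM2l; first exact: ltW.
  rewrite (big_cat_nat (leq0n s0) (leq_addr k s0))/=.
  by rewrite lerDr; apply: sumr_ge0 => i _; rewrite exprn_ge0.
have -> : 3 / (s0%:R * (1 - lam)) = 1 / (s0%:R * (1 - lam)) + 2 / (s0%:R * (1 - lam)).
  by rewrite -mulrDl; congr (_ / _); ring.
exact: lerD.
Qed.

End Reversible.

(** * Hitting times of half-lines *)

Record reversible_gap (R : realFieldType) (n : nat) (P : 'M[R]_n)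
    (p : 'I_n -> R) (lam : R) : Prop := ReversibleGap {
  rg_P0 : forall x y, 0 <= P x y;
  rg_P1 : forall x, \sum_y P x y = 1;
  rg_p0 : forall x, 0 < p x;
  rg_p1 : \sum_x p x = 1;
  rg_rev : forall x y, p x * P x y = p y * P y x;
  rg_lazy : forall x, 2^-1 <= P x x;
  rg_lam0 : 0 <= lam;
  rg_lam1 : lam < 1;
  rg_gap : forall f, \sum_x p x * f x = 0 -> ip p (op P f) f <= lam * ip p f f }.

(* [pos] is either the identity or the reversal of the states, so that both
   ends of the interval are treated at once. *)
Record semi_bd (R : realFieldType) (n : nat) (P : 'M[R]_n)
    (delta : R) (r : nat) (pos : 'I_n -> nat) : Prop := SemiBD {
  sb_inj : injective pos;
  sb_lt : forall x, (pos x < n)%N;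
  sb_delta0 : 0 < delta;
  sb_delta1 : delta <= 1;
  sb_r : (0 < r)%N;
  sb_far : forall x y, P x y != 0 -> (pos y <= pos x + r)%N /\ (pos x <= pos y + r)%N;
  sb_near : forall x y, pos y = (pos x).+1 \/ pos x = (pos y).+1 -> delta <= P x y }.

Section Hitting.
Variables (R : realFieldType) (n : nat) (P : 'M[R]_n) (p : 'I_n -> R).
Variables (lam delta : R) (r : nat) (pos : 'I_n -> nat).
Hypothesis rg : reversible_gap P p lam.
Hypothesis sb : semi_bd P delta r pos.
Implicit Types f g h u : 'I_n -> R.

Let P0 := rg_P0 rg.
Let P1 := rg_P1 rg.
Let p0 := rg_p0 rg.
Let d0 := sb_delta0 sb.
Let d1 := sb_delta1 sb.
Let p0' x : 0 <= p x := ltW (p0 x).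

(** * Minimum principle and Harnack inequality on the line *)

Lemma pos_onto i : (i < n)%N -> exists y, pos y = i.
Proof.
move=> ilt; pose q x : 'I_n := Ordinal (sb_lt sb x).
have qinj : injective q by move=> x y /(congr1 val) /= /(sb_inj sb).
exists (invF qinj (Ordinal ilt)).
by have /(congr1 val) := f_invF qinj (Ordinal ilt).
Qed.

Lemma op_shift f c x : op P f x - c = \sum_z P x z * (f z - c).
Proof.
under eq_bigr do rewrite mulrBr.
by rewrite sumrB -mulr_suml P1 mul1r.
Qed.

(** Among the minimisers over [Om] take the rightmost one: its right neighbour has a strictly larger
    value and is entered with probability at least [delta], against superharmonicity. Boundary
    values matter only at states reached by one jump, which later confines them to a window of
    length [r]. *)
Lemma min_principle w (Om : pred 'I_n) f m : (w < n)%N ->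
  (forall x, Om x -> (pos x < w)%N) ->
  (forall x, Om x -> op P f x <= f x) ->
  (forall x z, Om x -> ~~ Om z -> P x z != 0 -> m <= f z) ->
  forall x, Om x -> m <= f x.
Proof.
move=> wn Omw sup bd x0 Ox0; rewrite leNgt; apply/negP => x0m.
have [xm Oxm xmin] : exists2 xm, Om xm & forall x, Om x -> f xm <= f x.
  by case: (arg_minP f Ox0) => xm ? ?; exists xm.
have xmm : f xm < m by apply: le_lt_trans x0m; apply: xmin.
pose Q x := Om x && (f x == f xm).
have Qxm : Q xm by rewrite /Q Oxm eqxx.
case: (@arg_maxnP _ xm Q pos Qxm) => x /andP[Ox /eqP fx] xmax.
have [y yx] : exists y, pos y = (pos x).+1.
  by apply: pos_onto; apply: leq_ltn_trans wn; exact: Omw.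
have Pxy : delta <= P x y by apply: (sb_near sb); left.
have fz z : P x z != 0 -> f x <= f z.
  move=> Pz; case Oz: (Om z); first by rewrite fx xmin.
  by rewrite fx ltW// (lt_le_trans xmm)// (bd x)// Oz.
have fy : f x < f y.
  case Oy: (Om y); last first.
    rewrite fx (lt_le_trans xmm)// (bd x)// ?Oy//.
    by rewrite gt_eqF// (lt_le_trans d0).
  rewrite lt_neqAle fz ?andbT; last by rewrite gt_eqF// (lt_le_trans d0).
  apply/eqP => fxy; have := xmax y.
  by rewrite /Q Oy -fxy fx eqxx yx /= ltnn => /(_ isT).
have := sup x Ox; apply/negP; rewrite -ltNge -subr_gt0 op_shift.
rewrite (bigD1 y)//= ltr_pwDl//.
  by rewrite mulr_gt0 ?subr_gt0// (lt_le_trans d0).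
apply: sumr_ge0 => z _; have [->|Pz] := eqVneq (P x z) 0; first by rewrite mul0r.
by rewrite mulr_ge0// subr_ge0 fz.
Qed.

(** Superharmonicity and [f >= 0] give f(x) >= P(x,y) f(y) >= delta f(y) for neighbours; this is
    iterated along the line from [y] to [z]. Nonnegativity is required up to [a + r] because a jump
    from below [a] can land there. *)
Lemma harnack a f : (a < n)%N ->
  (forall x, (pos x < a + r)%N -> 0 <= f x) ->
  (forall x, (pos x < a)%N -> op P f x <= f x) ->
  forall k y z, (pos y < a)%N -> (pos z <= a)%N ->
  (pos y <= pos z + k)%N -> (pos z <= pos y + k)%N -> delta ^+ k * f z <= f y.
Proof.
move=> an f0 sup; have step x y : (pos x < a)%N ->
    pos y = (pos x).+1 \/ pos x = (pos y).+1 -> delta * f y <= f x.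
  move=> xa xy; apply: le_trans (sup x xa).
  have := sb_r sb => r0.
  have fy0 : 0 <= f y by apply: f0; clear -xa xy r0; lia.
  apply: le_trans (_ : P x y * f y <= _); first by rewrite ler_wpM2r// (sb_near sb).
  rewrite /op (bigD1 y)//= lerDl; apply: sumr_ge0 => z _.
  have [->|Pz] := eqVneq (P x z) 0; first by rewrite mul0r.
  by rewrite mulr_ge0// f0//; have [zx _] := sb_far sb Pz; clear -zx xa; lia.
have dk k c : 0 <= c -> delta ^+ k * c <= c.
  move=> c0; rewrite -[leRHS]mul1r ler_wpM2r// exprn_ile1//; exact: ltW.
elim=> [|k IH] y z ya za yz zy.
  have /(sb_inj sb) -> : pos y = pos z by clear -yz zy; lia.
  by rewrite expr0 mul1r.
have fz0 : 0 <= f z by apply: f0; have := sb_r sb; clear -za; lia.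
have [/(sb_inj sb) yz0|yzn] := eqVneq (pos y) (pos z).
  by rewrite -yz0 in fz0 *; exact: dk.
rewrite exprS -mulrA.
have [yz'|zy'] := ltnP (pos y) (pos z).
  have [y' ey'] : exists y', pos y' = (pos y).+1.
    by apply: pos_onto; clear -ya an; lia.
  apply: le_trans (step y y' ya (or_introl ey')).
  apply: ler_wpM2l; first exact: ltW.
  (* At level [a] the function need no longer be superharmonic, but then the path has already
     arrived at [z]. *)
  have [ey|ny] := eqVneq (pos y') a.
    have /(sb_inj sb) -> : pos y' = pos z by clear -ey ey' za yz'; lia.
    exact: dk.
  by apply: IH => //; clear -ya za yz zy yz' ey' ny; lia.
have [y' ey'] : exists y', pos y' = (pos y).-1.
  by apply: pos_onto; clear -ya an; lia.
apply: le_trans (step y y' ya _); last by right; clear -yzn zy' ey'; lia.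
by apply: ler_wpM2l; [exact: ltW | apply: IH => //; clear -ya za yz zy yzn zy' ey'; lia].
Qed.

(** * Green functions of the chain killed on a half-line *)

Variable w : nat.
Hypothesis wn : (w < n)%N.

(* [g x] is the expectation, started from [x], of the sum of [h] along the
   path up to the hitting time of the half-line [w <= pos]. *)
Definition green h g :=
  (forall x, (pos x < w)%N -> g x = op P g x + h x) /\
  (forall x, (w <= pos x)%N -> g x = 0).

Lemma green_ge0 h g : (forall x, (pos x < w)%N -> 0 <= h x) -> green h g ->
  forall x, 0 <= g x.
Proof.
move=> h0 [gS gL] x; have [xw|/gL ->//] := ltnP (pos x) w.
apply: (@min_principle w [pred x | pos x < w]%N) => //=.
  by move=> y yw; rewrite [leRHS]gS// lerDl h0.
by move=> y z _; rewrite -leqNgt => /gL ->.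
Qed.

Lemma green_comb (a b : R) h h' g g' : green h g -> green h' g' ->
  green (fun x => a * h x + b * h' x) (fun x => a * g x + b * g' x).
Proof.
move=> [gS gL] [gS' gL']; split=> x xw.
  by rewrite op_comb {1}gS// {1}gS'//; ring.
by rewrite gL// gL'//; ring.
Qed.

Lemma green_le h h' g g' : (forall x, (pos x < w)%N -> h x <= h' x) ->
  green h g -> green h' g' -> forall x, g x <= g' x.
Proof.
move=> hh G G' x; rewrite -subr_ge0.
have -> : g' x - g x = 1 * g' x + (- 1) * g x by ring.
apply: (green_ge0 _ (green_comb 1 (-1) G' G)) => y yw /=.
by have := hh y yw; lra.
Qed.

Lemma green_ext h h' g : (forall x, (pos x < w)%N -> h x = h' x) ->
  green h g -> green h' g.
Proof.
by move=> hh [gS gL]; split=> // x xw; rewrite gS// hh.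
Qed.

(** The equations form a square linear system, so existence follows from uniqueness, that is, from
    the minimum principle applied to a kernel vector and to its opposite. *)
Lemma green_exists h : exists g, green h g.
Proof.
pose M : 'M[R]_n := \matrix_(x, y) ((x == y)%:R - (pos x < w)%:R * P x y).
have ME g x : (M *m (\col_y g y)) x 0 = g x - (pos x < w)%:R * op P g x.
  rewrite mxE; under eq_bigr do rewrite !mxE mulrBl.
  rewrite sumrB; congr (_ - _).
    rewrite (bigD1 x)//= eqxx mul1r big1 ?addr0// => y /negPf.
    by rewrite eq_sym => ->; rewrite mul0r.
  by rewrite /op mulr_sumr; apply: eq_bigr => y _; rewrite mulrA.
have Mu : M \in unitmx.
  rewrite -unitmx_tr -row_free_unit -kermx_eq0; apply/rowV0P => v.
  move=> /sub_kermxP vM.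
  have Mv : M *m v^T = 0 by rewrite -[M]trmxK -trmx_mul vM trmx0.
  have G : green (fun=> 0) (fun x => v 0 x).
    have e x : v 0 x - (pos x < w)%:R * op P (v 0) x = 0.
      have vE : v^T = \col_y v 0 y by apply/matrixP => i j; rewrite !mxE ord1.
      by rewrite -ME -vE Mv mxE.
    split=> x xw; have := e x; first by rewrite xw mul1r addr0 => /subr0_eq.
    by rewrite ltnNge xw mul0r subr0.
  have G0 f : green (fun=> 0) f -> forall x, 0 <= f x by apply: green_ge0.
  apply/rowP => x; rewrite mxE; apply: le_anti; rewrite G0// andbT.
  have GN : green (fun=> 0) (fun x => -1 * v 0 x + 0 * v 0 x).
    by apply: green_ext (green_comb _ _ G G) => y _; rewrite !mulr0 addr0.
  by have := G0 _ GN x; rewrite mul0r addr0 mulN1r oppr_ge0.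
pose g : 'cV[R]_n := invmx M *m \col_x ((pos x < w)%:R * h x).
have gE : g = \col_y g y 0 by apply/matrixP => i j; rewrite !mxE ord1.
have Mg x : g x 0 - (pos x < w)%:R * op P (g^~ 0) x = (pos x < w)%:R * h x.
  by rewrite -(ME (g^~ 0)) -gE /g mulKVmx// mxE.
exists (g^~ 0); split=> x xw; have := Mg x.
  by rewrite xw !mul1r => <-; ring.
by rewrite ltnNge xw !mul0r subr0.
Qed.

Let pL := \sum_(x | (w <= pos x)%N) p x.

(** Since [g] vanishes on the half-line, Cauchy-Schwarz bounds its squared mean by (1 - pL) <g,g>,
    so its variance is at least pL <g,g>; the gap compares the variance with the Dirichlet form <g -
    Pg, g> = <g,h>. *)
Lemma green_dirichlet h g : green h g -> (1 - lam) * pL * ip p g g <= ip p g h.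
Proof.
move=> [gS gL]; pose mu := \sum_x p x * g x.
have mu2 : mu ^+ 2 <= (1 - pL) * ip p g g.
  pose i x : R := (pos x < w)%:R.
  have -> : mu = ip p i g.
    apply: eq_bigr => x _; rewrite /i; have [_|/gL ->] := ltnP (pos x) w.
      by rewrite mul1r.
    by rewrite !mulr0.
  suff -> : 1 - pL = ip p i i by exact: ip_CS.
  rewrite -(rg_p1 rg) (bigID (fun x => (w <= pos x)%N))/=. rewrite addrAC subrr add0r.
  rewrite /ip [RHS](bigID (fun x => (w <= pos x)%N))/= [X in X + _]big1 ?add0r.
    by apply: eq_bigr => x; rewrite -ltnNge /i => ->; rewrite !mulr1.
  by move=> x; rewrite /i ltnNge => ->; rewrite !mulr0.
pose f x := g x - mu.
have f0 : \sum_x p x * f x = 0.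
  under eq_bigr do rewrite mulrBr.
  by rewrite sumrB -mulr_suml (rg_p1 rg) mul1r subrr.
have ffE a b : ip p (fun x => a x - mu) (fun x => b x - mu) =
    ip p a b - mu * (\sum_x p x * a x) - mu * (\sum_x p x * b x) + mu ^+ 2.
  rewrite /ip -[X in _ = _ + X]mulr1 -(rg_p1 rg) !mulr_sumr -!sumrB -big_split.
  by apply: eq_bigr => x _ /=; ring.
have := rg_gap rg f0.
have -> : op P f = fun x => op P g x - mu by rewrite /f opB (op_cst P1).
rewrite !ffE (mean_op P1 (rg_rev rg)) -/mu => gap.
have -> : ip p g h = ip p g g - ip p (op P g) g.
  rewrite -ipBl ipC; apply: eq_bigr => x _; have [xw|/gL ->] := ltnP (pos x) w.
    by rewrite {2}gS//; ring.
  by rewrite !mulr0.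
have l1 : 0 < 1 - lam by rewrite subr_gt0 (rg_lam1 rg).
have := ler_wpM2l (ltW l1) mu2; move: gap.
set G := ip p g g; set G' := ip p _ _; set m2 := mu ^+ 2.
by rewrite -expr2 -/m2 => gap mu2'; nra.
Qed.

(** An upper bound for the relaxation time of the killed chain, of order trel as soon as the
    half-line has mass at least 1/3. *)
Variable tau : R.
Hypothesis tau0 : 0 <= tau.
Hypothesis tau_pL : 1 <= tau * ((1 - lam) * pL).

Lemma green_norm h g : green h g ->
  ip p g g <= tau ^+ 2 * \sum_(x | (pos x < w)%N) p x * h x ^+ 2.
Proof.
move=> G; pose hS x := (pos x < w)%:R * h x.
have GS : green hS g.
  by apply: green_ext G => x xw; rewrite /hS xw mul1r.
have -> : \sum_(x | (pos x < w)%N) p x * h x ^+ 2 = ip p hS hS.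
  rewrite big_mkcond; apply: eq_bigr => x _; rewrite /hS.
  by case: ifP; rewrite ?mul0r ?mulr0// !mul1r expr2.
have le1 : ip p g g <= tau * ip p g hS.
  have := ler_wpM2l tau0 (green_dirichlet GS); apply: le_trans.
  by rewrite mulrA ler_peMl// ip_ge0.
have cs := ip_CS p0' g hS.
have := ip_ge0 p0' g; rewrite le0r => /predU1P[->|g0].
  by rewrite mulr_ge0 ?sqr_ge0// ip_ge0.
rewrite -(ler_pM2l g0) -expr2.
apply: le_trans (_ : (tau * ip p g hS) ^+ 2 <= _).
  by rewrite ler_pXn2r// nnegrE ?(ltW g0)// (le_trans (ltW g0)).
by rewrite exprMn [leRHS]mulrCA ler_wpM2l// sqr_ge0.
Qed.

(** The Harnack constant: a state within [r] of a level is at most 2r steps away from any state of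
    the window of length [r] at that level. *)
Let c := delta ^+ (r + r).
Let c0 : 0 < c. Proof. by rewrite exprn_gt0. Qed.

(** Turns the norm bound into a pointwise one. The minimum of [g] over the window just below [j]
    bounds [g] from below on all of [pos <= j], since a walk from further left enters that window.
    The mass of [pos <= j], however small, then cancels, and Harnack passes from the minimum to
    every state near [j]. *)
Lemma green_window j h g (Lam : R) : (j < w)%N -> 0 <= Lam ->
  (forall x, (pos x < w)%N -> 0 <= h x) -> green h g ->
  \sum_(x | (pos x < w)%N) p x * h x ^+ 2 <=
    Lam ^+ 2 * \sum_(x | (pos x <= j)%N) p x ->
  forall z, (pos z <= j + r)%N -> (j <= pos z + r)%N -> c * g z <= Lam * tau.
Proof.
move=> jw Lam0 h0 G hL z zj jz; have g0 := green_ge0 h0 G.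
have [gS gL] := G.
have sup x : (pos x < w)%N -> op P g x <= g x.
  by move=> xw; rewrite [leRHS]gS// lerDl h0.
have [zw|/gL ->] := ltnP (pos z) w; last by rewrite mulr0 mulr_ge0.
have [yj yjE] : exists y, pos y = j by apply: pos_onto; exact: ltn_trans wn.
pose V x := (pos x <= j < pos x + r)%N.
have Vyj : V yj by rewrite /V yjE leqnn/= -addn1 leq_add2l (sb_r sb).
have [m Vm mmin] : exists2 m, V m & forall x, V x -> g m <= g x.
  by case: (arg_minP g Vyj) => m ? ?; exists m.
have lo x : (pos x <= j)%N -> g m <= g x.
  move=> xj; have [jx|jx] := ltnP j (pos x + r); first by apply: mmin; rewrite /V xj.
  apply: (@min_principle w [pred x | pos x + r <= j]%N) => //=.
  - by move=> y /= yj'; clear -yj' jw; lia.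
  - by move=> y /= yj'; apply: sup; clear -yj' jw; lia.
  - move=> y y' /= yy nyy Py; apply: mmin; rewrite /V.
    by have [] := sb_far sb Py; move: yy nyy; clear; lia.
have pj0 : 0 < \sum_(x | (pos x <= j)%N) p x.
  by rewrite (bigD1 yj) ?yjE//= ltr_pwDl// sumr_ge0.
have : g m <= Lam * tau.
  rewrite -(@ler_pXn2r _ 2)// ?nnegrE ?mulr_ge0//.
  rewrite -(ler_pM2r pj0).
  apply: le_trans (_ : ip p g g <= _).
    rewrite mulr_sumr /ip [leRHS](bigID (fun x => (pos x <= j)%N))/=.
    rewrite -[leLHS]addr0 lerD//; last first.
      by apply: sumr_ge0 => x _; rewrite mulr_ge0// mulr_ge0.
    apply: ler_sum => x xj; rewrite mulrC ler_wpM2l// expr2.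
    by rewrite ler_pM// lo.
  apply: le_trans (green_norm G) _.
  by rewrite exprMn [leRHS]mulrAC [leRHS]mulrC; apply: ler_wpM2l; rewrite ?sqr_ge0.
apply: le_trans.
move: Vm => /andP[mj jm].
by apply: (@harnack w g wn) => //; clear -mj jm jw zj jz zw; lia.
Qed.

Lemma local_bound j g : (j < w)%N -> green (fun x => (pos x <= j)%:R) g ->
  forall z, (pos z <= j + r)%N -> (j <= pos z + r)%N -> g z <= tau / c.
Proof.
move=> jw G z zj jz; rewrite ler_pdivlMr// mulrC -[leRHS]mul1r.
apply: (green_window jw _ _ G) => //.
rewrite expr1n mul1r big_mkcond [leRHS]big_mkcond; apply: ler_sum => x _.
have [xj|xj] := leqP (pos x) j.
  by rewrite (leq_ltn_trans xj jw) expr1n mulr1.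
by case: ifP; rewrite // expr0n/= mulr0.
Qed.

Lemma near_target_bound u : green (fun=> 1) u ->
  forall z, (w <= pos z + r)%N -> u z <= tau / c.
Proof.
move=> G z wz; have [zw|/(proj2 G) ->] := ltnP (pos z) w; last first.
  by rewrite divr_ge0// ltW.
apply: (@local_bound w.-1) => //; try (clear -zw wz; lia).
by apply: green_ext G => x xw; rewrite (_ : (pos x <= w.-1)%N = true)//; clear -xw; lia.
Qed.

Let c1 : c <= 1. Proof. by rewrite exprn_ile1// ltW. Qed.

(* Before leaving [pos <= j] a walk spends a time at most tau / c there, and
   the exit points of two walks started near [j] can be coupled with
   probability at least [c]. *)
Lemma oscillation_bound u : green (fun=> 1) u ->
  forall y z, (pos y <= pos z + r)%N -> (pos z <= pos y + r)%N ->
  u y - u z <= 2 * tau / c ^+ 2.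
Proof.
move=> G y1 z1 yz1 zy1; have [uS uL] := G.
have u0 : forall x, 0 <= u x by exact: (green_ge0 _ G).
pose close (q : 'I_n * 'I_n) :=
  ((pos q.1 <= pos q.2 + r) && (pos q.2 <= pos q.1 + r))%N.
have cl1 : close (y1, z1) by rewrite /close/= yz1.
have [[y0 z0] cl0 max0] : exists2 q, close q &
    forall q', close q' -> u q'.1 - u q'.2 <= u q.1 - u q.2.
  by case: (arg_maxP (fun q => u q.1 - u q.2) cl1) => q ? ?; exists q.
set D := u (y0, z0).1 - _ in max0.
have D0 : 0 <= D.
  by have := max0 (y1, y1); rewrite /close/= subrr leq_addr; apply.
have B0 : 0 <= tau / c by rewrite divr_ge0// ltW.
apply: le_trans (max0 (y1, z1) cl1) _ => /=.
(* [D] is the largest oscillation over all close pairs, so a bound of [D] by a contraction of itself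
   is enough. *)
suff key : D <= (1 - c) * D + 2 * (tau / c).
  rewrite expr2 invfM mulrA -/D ler_pdivlMr//.
  by move: key; rewrite -mulrA; set q := 2 * _; nra.
move: cl0 => /andP[/= yz zy].
have [y0w|y0w] := ltnP (pos y0) w; last first.
  rewrite {1}/D /= (uL y0)//.
  have : 0 <= (1 - c) * D by rewrite mulr_ge0// subr_ge0.
  by have := u0 z0; lra.
have [z0w|z0w] := ltnP (pos z0) w; last first.
  have uy : u y0 <= tau / c by apply: near_target_bound G _ _; clear -yz zy z0w; lia.
  rewrite {1}/D /= (uL z0)//.
  have : 0 <= (1 - c) * D by rewrite mulr_ge0// subr_ge0.
  lra.
pose j := maxn (pos y0) (pos z0).
have jw : (j < w)%N by rewrite gtn_max y0w.
have [g Gg] := green_exists (fun x => (pos x <= j)%:R).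
have [gS gL] := Gg.
have g0 : forall x, 0 <= g x by apply: (green_ge0 _ Gg) => x _; rewrite ler0n.
have gB := local_bound jw Gg.
have [a aE] : exists a, pos a = j.+1 by apply: pos_onto; clear -jw wn; lia.
pose win x := (j < pos x <= j + r)%N.
have wa : win a by rewrite /win aE; have := sb_r sb; clear; lia.
have [M wM Mmax] : exists2 x, win x & forall x', win x' -> u x' <= u x.
  by case: (arg_maxP u wa) => q ? ?; exists q.
have [m wm mmin] : exists2 x, win x & forall x', win x' -> u x <= u x'.
  by case: (arg_minP u wa) => q ? ?; exists q.
have MmD : u M - u m <= D.
  by apply: (max0 (M, m)); rewrite /close/=; move: wM wm; rewrite /win; clear; lia.
pose f x := u x - g x.
have harm x : (pos x <= j)%N -> op P f x = f x.
  move=> xj; have xw := leq_ltn_trans xj jw.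
  by rewrite /f opB [in RHS]uS// [in RHS]gS// xj /=; ring.
have exits x z : (pos x <= j)%N -> ~~ (pos z <= j)%N -> P x z != 0 -> win z.
  by move=> xj zj Pz; have [] := sb_far sb Pz; rewrite /win; move: xj zj; clear; lia.
have fM x : (pos x <= j + r)%N -> 0 <= u M - f x.
  move=> xjr; have [xj|xj] := leqP (pos x) j; last first.
    have : win x by rewrite /win xj.
    by move/Mmax; rewrite /f; have := g0 x; lra.
  apply: (@min_principle w [pred x | pos x <= j]%N (fun x => u M - f x)) => //=.
  - by move=> y /= /leq_ltn_trans; apply.
  - by move=> y /= yj; rewrite opB (op_cst P1) harm.
  - move=> y z /= yj zj Pz; have /Mmax := exits _ _ yj zj Pz.
    by rewrite /f; have := g0 z; lra.
pose lo := u m - tau / c.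
have fm x : (pos x <= j + r)%N -> 0 <= f x - lo.
  have W z : win z -> 0 <= f z - lo.
    move=> wz; have := mmin _ wz; have : g z <= tau / c.
      by apply: gB; move: wz; rewrite /win; clear; lia.
    by rewrite /f /lo; lra.
  move=> xjr; have [xj|xj] := leqP (pos x) j; last first.
    by apply: W; rewrite /win xj.
  apply: (@min_principle w [pred x | pos x <= j]%N (fun x => f x - lo)) => //=.
  - by move=> y /= /leq_ltn_trans; apply.
  - by move=> y /= yj; rewrite opB (op_cst P1) harm.
  - by move=> y z /= yj zj Pz; apply/W/(exits y).
have jn := leq_ltn_trans jw wn.
have r0 := sb_r sb.
have [yj zj] : (pos y0 <= j)%N /\ (pos z0 <= j)%N.
  by rewrite leq_maxl leq_maxr.
have [jy jz] : (j <= pos y0 + r)%N /\ (j <= pos z0 + r)%N.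
  by rewrite /j; move: yz zy; clear; lia.
(* Harnack for the two nonnegative harmonic functions [u M - f] and [f - lo], both compared with the
   same exit state [a]: this is the coupling with probability [c]. *)
have hy : c * (u M - f a) <= u M - f y0.
  apply: (@harnack j.+1 (fun x => u M - f x) jn); rewrite ?aE; try (clear -yj jy r0; lia).
    by move=> x xj; apply: fM; move: (xj); rewrite addSn ltnS.
  by move=> x; rewrite ltnS => xj; rewrite opB (op_cst P1) harm.
have hz : c * (f a - lo) <= f z0 - lo.
  apply: (@harnack j.+1 (fun x => f x - lo) jn); rewrite ?aE; try (clear -zj jz r0; lia).
    by move=> x xj; apply: fm; move: (xj); rewrite addSn ltnS.
  by move=> x; rewrite ltnS => xj; rewrite opB (op_cst P1) harm.
have gy : g y0 <= tau / c by apply: gB; rewrite ?jy// (leq_trans yj) ?leq_addr.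
have gz := g0 z0.
have DE : D = f y0 - f z0 + g y0 - g z0 by rewrite /D /f/=; ring.
have : (1 - c) * (u M - u m) <= (1 - c) * D by rewrite ler_wpM2l// subr_ge0.
have : 0 <= c * (tau / c) by rewrite mulr_ge0// ltW.
move: hy hz; rewrite DE /lo -/c; move: (f a) (f y0) (f z0) (g y0) gy.
by move=> *; nra.
Qed.

Let K := 2 * tau / c ^+ 2 + tau / c.

(** Up to [j] the function [u - g] is harmonic, and at the exit states it is at least [u a - K] by
    the oscillation bound. Above [j] it is [g] that is harmonic until the walk falls back near [j],
    where it is at most [tau / c]. *)
Lemma local_excess u j g a : (j < w)%N -> green (fun=> 1) u ->
  green (fun x => (pos x <= j)%:R) g -> pos a = j ->
  forall x, g x <= Num.max (u x - u a) 0 + K.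
Proof.
move=> jw Gu Gg aj x; have [uS uL] := Gu; have [gS gL] := Gg.
have gB := local_bound jw Gg.
have B0 : 0 <= tau / c by rewrite divr_ge0// ltW.
have D0 : 0 <= 2 * tau / c ^+ 2 by rewrite divr_ge0 ?mulr_ge0// exprn_ge0// ltW.
have [xj|jx] := leqP (pos x) j.
  apply: le_trans (_ : u x - u a + K <= _); last by rewrite lerD2r le_max lexx.
  suff : u a - K <= u x - g x by lra.
  apply: (@min_principle w [pred x | pos x <= j]%N (fun x => u x - g x)) => //=.
  - by move=> y /= /leq_ltn_trans; apply.
  - move=> y /= yj; have yw := leq_ltn_trans yj jw.
    by rewrite opB [in leRHS]uS// [in leRHS]gS// yj /=; lra.
  - move=> y z /= yj; rewrite -ltnNge => jz /(sb_far sb)[zy yz].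
    have za : (pos z <= pos a + r)%N by rewrite aj (leq_trans zy)// leq_add2r.
    have az : (pos a <= pos z + r)%N by rewrite aj (leq_trans (ltnW jz))// leq_addr.
    have := oscillation_bound Gu az za.
    have : g z <= tau / c by apply: gB; rewrite -?aj.
    by rewrite /K; lra.
apply: le_trans (_ : tau / c <= _); last first.
  apply: (@le_trans _ _ (0 + K)); last by rewrite lerD2r le_max lexx orbT.
  by rewrite /K add0r lerDr.
have [xw|/gL ->//] := ltnP (pos x) w.
rewrite -lerN2.
apply: (@min_principle w [pred x | j < pos x < w]%N (fun x => - g x)) => //=.
- by move=> y /= /andP[].
- move=> y /= /andP[jy yw]; rewrite [in leRHS]gS// leqNgt jy /= addr0.
  by rewrite /op -sumrN; apply: ler_sum => z _; rewrite mulrN.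
- move=> y z /= /andP[jy yw] zn /(sb_far sb)[zy yz]; rewrite lerN2.
  have [/gL ->//|zw] := leqP w (pos z).
  move: zn; rewrite zw andbT -leqNgt => zj.
  apply: gB; first by rewrite (leq_trans zj)// leq_addr.
  exact: leq_trans (ltnW jy) yz.
- by rewrite jx.
Qed.

Lemma green_sum (m : nat) (a : nat -> R) (h g : nat -> 'I_n -> R) :
  (forall j, green (h j) (g j)) ->
  green (fun x => \sum_(0 <= j < m) a j * h j x)
        (fun x => \sum_(0 <= j < m) a j * g j x).
Proof.
move=> G; elim: m => [|m IH].
  split=> x _; rewrite !big_geq//.
  by rewrite /op big1 ?addr0// => y _; rewrite big_geq// mulr0.
have := green_comb 1 (a m) IH (G m); congr green; apply/funext => x;
  by rewrite big_nat_recr//= mul1r.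
Qed.

(** A lower Riemann sum of the decreasing function max(t - s, 0) of s over [b, a]. *)
Lemma sqr_telescope_step (a b t : R) : b <= a ->
  (a - b) * Num.max (t - a) 0 <=
  2^-1 * (Num.max (t - b) 0 ^+ 2 - Num.max (t - a) 0 ^+ 2).
Proof.
move=> ba; have [ta|ta] := leP (t - a) 0.
  rewrite mulr0 expr0n subr0 mulr_ge0// ?invr_ge0// ?sqr_ge0//.
rewrite (max_l _); last by lra.
have := sqr_ge0 (a - b); nra.
Qed.

(* The walk has spent at least about u(x) - u(a) before passing the level j
   of a, and a time at most K around and below j after that.  Summing over the
   levels of the nonincreasing majorant ubar of u gives
   N <= u^2 / 2 + K sup u, where N(x) = E_x[T (T + 1)] / 2 for the hitting
   time T. *)
Lemma second_moment_le u N (U : R) : green (fun=> 1) u -> green u N ->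
  (forall x, u x <= U) -> forall x, N x <= 2^-1 * u x ^+ 2 + K * U.
Proof.
move=> Gu GN uU x.
have u0 : forall x, 0 <= u x by exact: (green_ge0 _ Gu).
have K0 : 0 <= K.
  by rewrite addr_ge0 ?divr_ge0 ?mulr_ge0 ?exprn_ge0// ltW.
pose ub j := \big[Num.max/0]_(y | (j <= pos y)%N) u y.
have ub0 j : 0 <= ub j by rewrite /ub; apply: bigmax_ge_id.
have ubw : ub w = 0.
  apply: le_anti; rewrite ub0 andbT; apply: bigmax_le => // y wy.
  by rewrite (proj2 Gu).
have uub y j : (j <= pos y)%N -> u y <= ub j.
  by move=> jy; apply: (le_bigmax_cond _ _ jy).
have ubS j a : pos a = j -> ub j = Num.max (u a) (ub j.+1).
  move=> aj; apply: le_anti; apply/andP; split.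
    apply: bigmax_le => [|y]; first by rewrite le_max ub0 orbT.
    rewrite leq_eqVlt => /predU1P[e|jy]; rewrite le_max.
      by have -> : y = a; [apply: (sb_inj sb); rewrite aj -e | rewrite lexx].
    by rewrite (uub _ _ jy) orbT.
  rewrite ge_max uub ?aj//=; apply: bigmax_le => // y jy.
  by rewrite uub// ltnW.
have ubU j : ub j <= U.
  by apply: bigmax_le => //; exact: le_trans (u0 x) (uU x).
have [g Gg] := choice (fun j => green_exists (fun x => (pos x <= j)%:R)).
(* Abel summation: as [ub] vanishes at [w], the source [u] of [N] is dominated by a combination of
   the indicators of [pos <= j]. *)
have main : N x <= \sum_(0 <= j < w) (ub j - ub j.+1) * g j x.
  apply: (green_le _ GN (green_sum w (fun j => ub j - ub j.+1) Gg)) => y yw.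
  apply: (@le_trans _ _ (ub (pos y))); first exact: uub.
  rewrite (big_cat_nat (leq0n _) (ltnW yw))/= big_nat big1 ?add0r; last first.
    by move=> j /andP[_ jy]; rewrite leqNgt jy mulr0.
  rewrite big_nat; under eq_bigr => j /andP[yj _] do rewrite yj mulr1 -opprB.
  by rewrite -big_nat sumrN telescope_sumr 1?ltnW// ubw sub0r opprK.
apply: le_trans main _; pose q a := Num.max (u x - a) 0 ^+ 2.
apply: (@le_trans _ _ (\sum_(0 <= j < w)
  (2^-1 * (q (ub j.+1) - q (ub j)) - K * (ub j.+1 - ub j)))).
  rewrite big_nat [leRHS]big_nat; apply: ler_sum => j /andP[_ jw].
  have [a aj] : exists a, pos a = j by apply: pos_onto; exact: ltn_trans wn.
  have ubj : ub j.+1 <= ub j by rewrite (ubS _ _ aj) le_max lexx orbT.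
  (* Only levels where [ub] drops contribute, and there the maximum is attained at [a] itself, so
     [u a = ub j]. *)
  have [e|ne] := eqVneq (ub j) (ub j.+1).
    by rewrite e !subrr mul0r !mulr0 subrr.
  have ua : u a = ub j.
    by move: ne; rewrite (ubS _ _ aj) maxEle; case: ifP => //; rewrite eqxx.
  have := local_excess jw Gu (Gg j) aj x; rewrite ua => ge.
  have := sqr_telescope_step (u x) ubj; rewrite -/(q _) -/(q _) => st.
  have : (ub j - ub j.+1) * g j x <=
      (ub j - ub j.+1) * (Num.max (u x - ub j) 0 + K).
    by rewrite ler_wpM2l// subr_ge0.
  by rewrite mulrDr; lra.
rewrite sumrB -!mulr_sumr !telescope_sumr// ubw sub0r.
have -> : q 0 = u x ^+ 2 by rewrite /q subr0 max_l.
have : 0 <= q (ub 0%N) by rewrite sqr_ge0.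
have : K * ub 0%N <= K * U by rewrite ler_wpM2l.
by rewrite mulrN; lra.
Qed.

(** * Variance and tails of the hitting time *)

Section Variance.
Variables u N : 'I_n -> R.
Hypothesis Gu : green (fun=> 1) u.
Hypothesis GN : green u N.

(** As [N] is the mean of T(T + 1)/2, the term [2 * N x - u x] is the mean of T^2. *)
Definition hitting_variance x := 2 * N x - u x - u x ^+ 2.

Let u0 : forall x, 0 <= u x. Proof. exact: (green_ge0 _ Gu). Qed.

Lemma hitting_variance_le (U : R) x : (forall x, u x <= U) -> hitting_variance x <= 2 * K * U.
Proof.
move=> uU; have := second_moment_le Gu GN uU x; have := u0 x.
by rewrite /hitting_variance; lra.
Qed.

(** Off the half-line the variance exceeds its one-step mean by the variance of [u] after one step,
    so it is superharmonic; it vanishes on the half-line. *)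
Lemma hitting_variance_ge0 x : 0 <= hitting_variance x.
Proof.
have [uS uL] := Gu; have [NS NL] := GN.
have [xw|xw] := ltnP (pos x) w; last first.
  by rewrite /hitting_variance uL// NL// expr0n/=; lra.
apply: (@min_principle w [pred x | pos x < w]%N hitting_variance) => //=; last first.
  by move=> y z _; rewrite -leqNgt => wz _; rewrite /hitting_variance uL// NL// expr0n/=; lra.
move=> y yw; have ou : op P u y = u y - 1 by rewrite [in RHS]uS// addrK.
have oN : op P N y = N y - u y by rewrite [in RHS]NS// addrK.
have -> : op P hitting_variance y = 2 * op P N y - op P u y - op P (fun z => u z ^+ 2) y.
  rewrite /op mulr_sumr -!sumrB; apply: eq_bigr => z _; rewrite /hitting_variance; ring.
have : 0 <= \sum_z P y z * (u z - (u y - 1)) ^+ 2.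
  by apply: sumr_ge0 => z _; rewrite mulr_ge0 ?sqr_ge0.
have -> : \sum_z P y z * (u z - (u y - 1)) ^+ 2 =
    op P (fun z => u z ^+ 2) y - 2 * (u y - 1) * op P u y + (u y - 1) ^+ 2.
  transitivity (\sum_z (P y z * u z ^+ 2 - 2 * (u y - 1) * (P y z * u z) +
      P y z * (u y - 1) ^+ 2)); first by apply: eq_bigr => z _; ring.
  by rewrite big_split sumrB /= -mulr_sumr -mulr_suml P1 mul1r.
rewrite ou oN /hitting_variance; set S2 := op P (fun z => _) y.
rewrite !expr2; lra.
Qed.

(* [tail t x] is the probability that the chain started at [x] has not hit
   [w <= pos] by time [t]. *)
Fixpoint tail t x : R :=
  if (pos x < w)%N then
    if t is t'.+1 then op P (tail t') x else 1
  else 0.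

Lemma tailL t x : (w <= pos x)%N -> tail t x = 0.
Proof. by case: t => [|t] /=; rewrite ltnNge => ->. Qed.

Lemma tailS t x : (pos x < w)%N -> tail t.+1 x = op P (tail t) x.
Proof. by move=> /= ->. Qed.

Lemma tail0 x : (pos x < w)%N -> tail 0 x = 1.
Proof. by move=> /= ->. Qed.

Lemma tail_ge0 t x : 0 <= tail t x.
Proof.
elim: t x => [|t IH] x /=; case: ifP => // _.
by apply: sumr_ge0 => y _; rewrite mulr_ge0.
Qed.

Lemma tail_le1 t x : tail t x <= 1.
Proof.
elim: t x => [|t IH] x /=; case: ifP => // _.
by apply: le_trans (op_le P0 IH x) _; rewrite op_cst.
Qed.

(** The mean of (s + T - e)^2, where [s] is the time already elapsed and [e] a fixed centre. *)
Let second_moment (s : nat) (e : R) x := hitting_variance x + (u x + s%:R - e) ^+ 2.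

Lemma second_momentS s e x : (pos x < w)%N ->
  second_moment s e x = op P (second_moment s.+1 e) x.
Proof.
have [uS uL] := Gu; have [NS NL] := GN.
move=> xw; have ou : op P u x = u x - 1 by rewrite [in RHS]uS// addrK.
have oN : op P N x = N x - u x by rewrite [in RHS]NS// addrK.
have -> : op P (second_moment s.+1 e) x = 2 * op P N x - op P u x +
    2 * (s.+1%:R - e) * op P u x + (s.+1%:R - e) ^+ 2.
  have -> : (s.+1%:R - e) ^+ 2 = \sum_z P x z * (s.+1%:R - e) ^+ 2.
    by rewrite -mulr_suml P1 mul1r.
  rewrite /op !mulr_sumr -sumrB -!big_split; apply: eq_bigr => z _ /=.
  by rewrite /second_moment /hitting_variance; ring.
by rewrite ou oN /second_moment /hitting_variance -natr1; ring.
Qed.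

Lemma second_moment_ge0 s e x : 0 <= second_moment s e x.
Proof. by rewrite addr_ge0 ?hitting_variance_ge0 ?sqr_ge0. Qed.

(** Chebyshev by induction on time: each step moves one unit from [t] to [s], leaving [s + t - e]
    unchanged. *)
Lemma tail_upper_aux t s e x : 0 <= s%:R + t%:R - e ->
  tail t x * (s%:R + t%:R - e) ^+ 2 <= second_moment s e x.
Proof.
elim: t s x => [|t IH] s x; (have [xw|xw] := ltnP (pos x) w;
    last by rewrite tailL// mul0r second_moment_ge0).
  rewrite tail0// mul1r addr0 => se; rewrite -[leLHS]add0r lerD ?hitting_variance_ge0//.
  have := u0 x; nra.
move=> se; rewrite tailS// second_momentS// /op mulr_suml.
apply: ler_sum => z _; rewrite -mulrA ler_wpM2l//.
have -> : s%:R + t.+1%:R - e = s.+1%:R + t%:R - e by rewrite -!natr1; ring.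
by apply: IH; move: se; rewrite -!natr1; lra.
Qed.

Lemma tail_upper t x : u x <= t%:R -> tail t x * (t%:R - u x) ^+ 2 <= hitting_variance x.
Proof.
move=> ut; have := @tail_upper_aux t 0 (u x) x.
rewrite add0r subr_ge0 => /(_ ut) /le_trans; apply.
by rewrite /second_moment addr0 subrr expr0n/= addr0.
Qed.

Lemma tail_lower_aux t s e x : s%:R + t%:R <= e ->
  (1 - tail t x) * (e - s%:R - t%:R) ^+ 2 <= second_moment s e x.
Proof.
have hL t' s' x' : (w <= pos x')%N -> s'%:R + t'%:R <= e ->
    (1 - tail t' x') * (e - s'%:R - t'%:R) ^+ 2 <= second_moment s' e x'.
  move=> xw se; rewrite tailL// subr0 mul1r /second_moment.
  rewrite -[leLHS]add0r lerD ?hitting_variance_ge0// (proj2 Gu)//.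
  have : 0 <= t'%:R :> R by rewrite ler0n.
  nra.
elim: t s x => [|t IH] s x se; (have [xw|xw] := ltnP (pos x) w; last exact: hL).
  by rewrite tail0// subrr mul0r second_moment_ge0.
rewrite tailS// second_momentS//.
have -> : 1 - op P (tail t) x = op P (fun z => 1 - tail t z) x.
  by rewrite opB op_cst.
rewrite /op mulr_suml; apply: ler_sum => z _; rewrite -mulrA ler_wpM2l//.
have -> : e - s%:R - t.+1%:R = e - s.+1%:R - t%:R by rewrite -!natr1; ring.
by apply: IH; move: se; rewrite -!natr1; lra.
Qed.

Lemma tail_lower t x : t%:R <= u x ->
  (1 - tail t x) * (u x - t%:R) ^+ 2 <= hitting_variance x.
Proof.
move=> ut; have := @tail_lower_aux t 0 (u x) x.
rewrite add0r subr0 => /(_ ut) /le_trans; apply.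
by rewrite /second_moment addr0 subrr expr0n/= addr0.
Qed.

Lemma tail_markov t x : t.+1%:R * tail t x <= u x.
Proof.
elim: t x => [|t IH] x; (have [xw|xw] := ltnP (pos x) w; last by rewrite tailL ?mulr0).
  rewrite mul1r tail0// (proj1 Gu)// lerDr.
  by apply: sumr_ge0 => y _; rewrite mulr_ge0.
rewrite -natr1 mulrDl mul1r [leRHS](proj1 Gu)// lerD//; last exact: tail_le1.
rewrite tailS// /op mulr_sumr; apply: ler_sum => y _.
by rewrite mulrCA ler_wpM2l.
Qed.

Lemma mean_le_tail (U : R) t x : (forall x, u x <= U) ->
  u x <= t%:R + U * tail t x.
Proof.
move=> uU; have U0 : 0 <= U by exact: le_trans (u0 x) (uU x).
elim: t x => [|t IH] x; (have [xw|xw] := ltnP (pos x) w;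
    last by rewrite tailL// mulr0 addr0 (proj2 Gu)).
  by rewrite tail0// mulr1 add0r.
rewrite tailS// [leLHS](proj1 Gu)// -natr1 addrAC lerD2r.
apply: le_trans (op_le P0 IH x) _.
have -> : (fun y => t%:R + U * tail t y) = (fun y => 1 * (t%:R) + U * tail t y).
  by apply/funext => y; rewrite mul1r.
by rewrite op_comb op_cst// mul1r.
Qed.

End Variance.

(** Markov property at time [t], the condition of having survived until [t] being dropped. *)
Lemma tail_le_iter t x (A : {set 'I_n}) s (th : R) :
  (forall y, y \notin A -> tail s y <= th) -> 0 <= th ->
  tail (t + s)%N x <= iter t (op P) (fun y => (y \in A)%:R) x + th.
Proof.
move=> hA th0; elim: t x => [|t IH] x /=.
  have [xA|/hA h] := boolP (x \in A); last by rewrite add0r.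
  by apply: (le_trans (tail_le1 _ _)); rewrite lerDl.
have f0 : forall z, 0 <= iter t (op P) (fun y => (y \in A)%:R) z.
  elim: t {IH} => [|t IH] z /=; first by rewrite ler0n.
  by apply: sumr_ge0 => y _; rewrite mulr_ge0.
case: ifP => _; last by rewrite addr_ge0//; apply: sumr_ge0 => y _; rewrite mulr_ge0.
apply: le_trans (op_le P0 IH x) _.
set f := iter t _ _.
have -> : (fun y => f y + th) = (fun y => 1 * f y + 1 * th).
  by apply/funext => y; rewrite !mul1r.
by rewrite op_comb op_cst// !mul1r.
Qed.

End Hitting.

(** * Mixing and hitting *)

Section GoodWindow.
Variables (R : realType) (n : nat) (P : 'M[R]_n) (p : 'I_n -> R).
Variables (lam delta : R) (r : nat) (pos : 'I_n -> nat).
Hypothesis rg : reversible_gap P p lam.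
Hypothesis sb : semi_bd P delta r pos.

Let P0 := rg_P0 rg.
Let P1 := rg_P1 rg.
Let p0 x : 0 <= p x := ltW (rg_p0 rg x).
Let d0 := sb_delta0 sb.

Lemma weight_ratio k x y : pos y = (pos x + k)%N -> delta ^+ k * p x <= p y.
Proof.
elim: k y => [|k IH] y xy.
  by rewrite expr0 mul1r; have -> // : y = x; apply: (sb_inj sb); rewrite xy addn0.
have [z zx] : exists z, pos z = (pos x + k)%N.
  by apply: (pos_onto sb); apply: leq_ltn_trans (sb_lt sb y); rewrite xy addnS.
rewrite exprS -mulrA; apply: (@le_trans _ _ (delta * p z)).
  by apply: ler_wpM2l; [exact: ltW | exact: IH].
have yz : pos y = (pos z).+1 by rewrite xy zx addnS.
apply: (@le_trans _ _ (p z * P z y)).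
  by rewrite mulrC ler_wpM2l// (sb_near sb)//; left.
rewrite (rg_rev rg) -[leRHS]mulr1 ler_wpM2l// -(P1 y) (bigD1 z)//= lerDl.
by apply: sumr_ge0.
Qed.

Lemma card_window (b : 'I_n) : (#|[pred y | pos y <= pos b < pos y + r]| <= r)%N.
Proof.
set A := [pred y | _]; rewrite cardE -(size_map pos) -(size_iota ((pos b).+1 - r) r).
apply: uniq_leq_size.
  by rewrite map_inj_uniq ?enum_uniq//; exact: (sb_inj sb).
move=> i /mapP[y]; rewrite mem_enum inE mem_iota => /andP[yb by_] ->.
by apply/andP; split; move: yb by_; clear; lia.
Qed.

(** Otherwise every state of the middle part, of mass more than 1/3, has a bad state in the [r]
    places starting at it, of weight at least [delta ^+ r] times its own. Each bad state serves at
    most [r] of them, which makes the bad mass too large. *)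
Lemma good_window (bad : pred 'I_n) :
  r%:R * (\sum_(x | bad x) p x) * 3 < delta ^+ r ->
  exists w, [/\ (w < n)%N, forall y, (w <= pos y < w + r)%N -> ~~ bad y,
    3^-1 <= \sum_(x | (w <= pos x)%N) p x &
    3^-1 <= \sum_(x | (pos x < w + r)%N) p x].
Proof.
move=> small.
pose up y := \sum_(x | (pos y <= pos x)%N) p x.
pose dn y := \sum_(x | (pos x <= pos y)%N) p x.
pose mid y := (3^-1 <= up y) && (3^-1 <= dn y).
have sub (A B : pred 'I_n) : (forall x, A x -> B x) ->
    \sum_(x | A x) p x <= \sum_(x | B x) p x.
  move=> AB; rewrite [leRHS]big_mkcond [leLHS]big_mkcond; apply: ler_sum => x _.
  by case: ifP => [/AB ->//|_]; case: ifP.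
have third : 0 < 3^-1 :> R by rewrite invr_gt0.
(* All these states lie to the right of the leftmost one of them, whose [up] is below 1/3. *)
have hi : \sum_(y | up y < 3^-1) p y < 3^-1.
  have [y0 hy0|no] := pickP [pred y | up y < 3^-1]; last by rewrite big_pred0.
  case: (arg_minnP pos hy0) => y /= hy ymin.
  by apply: le_lt_trans hy; apply: sub => x /ymin.
have lo : \sum_(y | dn y < 3^-1) p y < 3^-1.
  have [y0 hy0|no] := pickP [pred y | dn y < 3^-1]; last by rewrite big_pred0.
  case: (arg_maxnP pos hy0) => y /= hy ymax.
  by apply: le_lt_trans hy; apply: sub => x /ymax.
have midp : 3^-1 < \sum_(y | mid y) p y.
  have : \sum_y p y <= \sum_(y | mid y) p y + \sum_(y | up y < 3^-1) p y +
      \sum_(y | dn y < 3^-1) p y.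
    rewrite [X in _ <= X + _ + _]big_mkcond [X in _ <= _ + X + _]big_mkcond.
    rewrite [X in _ <= _ + _ + X]big_mkcond -!big_split; apply: ler_sum => y _ /=.
    rewrite /mid; case: (leP _ (up y)) => _; case: (leP _ (dn y)) => _ /=;
      by have := p0 y; lra.
  rewrite (rg_p1 rg) => h; have : 3 * 3^-1 = 1 :> R by rewrite divff ?pnatr_eq0.
  lra.
have [all|] := boolP [forall y, mid y ==> [exists b, bad b &&
    (pos y <= pos b < pos y + r)%N]]; last first.
  rewrite negb_forall => /existsP[y]; rewrite negb_imply negb_exists.
  move=> /andP[/andP[uy dy] /forallP nb]; exists (pos y); split => //.
  - exact: (sb_lt sb).
  - by move=> z zy; have := nb z; rewrite zy andbT.
  - apply: le_trans dy _; apply: sub => x /leq_ltn_trans; apply.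
    by rewrite -addn1 leq_add2l (sb_r sb).
have : delta ^+ r * \sum_(y | mid y) p y <= r%:R * \sum_(b | bad b) p b.
  apply: (@le_trans _ _ (\sum_y \sum_(b | bad b && (pos y <= pos b < pos y + r)%N) p b)).
    rewrite mulr_sumr big_mkcond; apply: ler_sum => y _; case: ifP => my; last first.
      by rewrite sumr_ge0.
    have /existsP[b /andP[bb /andP[yb by_]]] := implyP (forallP all y) my.
    rewrite (bigD1 b)/= ?bb ?yb//; apply: (@le_trans _ _ (p b)); last first.
      by rewrite lerDl sumr_ge0.
    apply: le_trans (weight_ratio (esym (subnKC yb))); rewrite ler_wpM2r//.
    rewrite -(@subnK (pos b - pos y) r); last by rewrite leq_subLR ltnW.
    rewrite exprD ler_piMl ?exprn_ge0 ?exprn_ile1// ?(sb_delta1 sb) ?ltW//.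
  rewrite (exchange_big_dep bad)/=; last by move=> y b _ /andP[].
  rewrite mulr_sumr; apply: ler_sum => b bb.
  under eq_bigl do rewrite bb.
  by rewrite sumr_const -[leLHS]mulr_natl ler_wpM2r// ler_nat card_window.
have : delta ^+ r * 3^-1 <= delta ^+ r * \sum_(y | mid y) p y.
  by rewrite ler_wpM2l ?exprn_ge0 ?ltW.
move=> h1 h2; have := le_trans h1 h2; rewrite ler_pdivrMr// leNgt.
by rewrite small.
Qed.

(** A walk coming from the left cannot jump over the window, so it either survives or enters it. The
    entrance time is random, hence the bound on the window at every time from [s0] to [s0 + t]. *)
Lemma tail_dominates (f : 'I_n -> R) w th s0 t : 0 <= th ->
  (forall k y, (k <= t)%N -> (w <= pos y < w + r)%N -> iter (s0 + k) (op P) f y <= th) ->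
  (forall y, iter s0 (op P) f y <= 1) ->
  forall k x, (k <= t)%N -> (pos x < w + r)%N ->
    iter (s0 + k) (op P) f x <= th + tail P pos w k x.
Proof.
move=> th0 good f1; elim=> [|k IH] x kt xw.
  have [wx|wx] := leqP w (pos x).
    by rewrite tailL// addr0 good// wx.
  by rewrite tail0// addn0; apply: (le_trans (f1 x)); rewrite lerDr.
have [wx|wx] := leqP w (pos x); first by rewrite tailL// addr0 good// wx.
rewrite tailS// addnS iterS.
have -> : th + op P (tail P pos w k) x = op P (fun y => 1 * th + 1 * tail P pos w k y) x.
  by rewrite op_comb op_cst// !mul1r.
apply: ler_sum => y _; have [->|Py] := eqVneq (P x y) 0; first by rewrite !mul0r.
rewrite ler_wpM2l// !mul1r; apply: IH; first exact: ltnW.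
by have [yx _] := sb_far sb Py; apply: leq_ltn_trans yx _; rewrite ltn_add2r.
Qed.

End GoodWindow.

(** Total variation as a supremum over events; passing to complements makes the one-sided bound
    sufficient. *)
Definition mixed (R : realType) (n : nat) (P : 'M[R]_n) (p : 'I_n -> R)
    (a : R) (t : nat) : Prop :=
  forall x (A : {set 'I_n}),
    iter t (op P) (fun y => (y \in A)%:R) x - \sum_(y in A) p y <= a.

(** * Tails of hitting times in terms of mixing times *)

Section HittingTail.
Variables (R : realType) (n : nat) (P : 'M[R]_n) (p : 'I_n -> R).
Variables (lam delta : R) (r : nat) (pos : 'I_n -> nat).
Hypothesis rg : reversible_gap P p lam.
Hypothesis sb : semi_bd P delta r pos.
Variable w : nat.
Hypothesis wn : (w < n)%N.
Hypothesis wp : 3^-1 <= \sum_(x | (w <= pos x)%N) p x.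

Let P0 := rg_P0 rg.
Let P1 := rg_P1 rg.
Let p0 x : 0 <= p x := ltW (rg_p0 rg x).
Let c := delta ^+ (r + r).
Let c0 : 0 < c. Proof. by rewrite exprn_gt0// (sb_delta0 sb). Qed.
Let c1 : c <= 1.
Proof. by rewrite exprn_ile1// ?(sb_delta1 sb)// ltW// (sb_delta0 sb). Qed.
Let T := (1 - lam)^-1.
Let T1 : 1 <= T.
Proof.
by rewrite invf_ge1 ?subr_gt0 ?(rg_lam1 rg)// lerBlDr lerDl (rg_lam0 rg).
Qed.
Let T0 : 0 <= T. Proof. exact: le_trans T1. Qed.
Let tau := 3 * T.
Let tau0 : 0 <= tau. Proof. by rewrite mulr_ge0. Qed.
Let tau_p : 1 <= tau * ((1 - lam) * \sum_(x | (w <= pos x)%N) p x).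
Proof.
have l1 : 1 - lam != 0 by rewrite subr_eq0 gt_eqF// (rg_lam1 rg).
rewrite /tau /T; set S := \sum_(x | _) _; have wS : 3^-1 <= S by [].
have -> : 3 * (1 - lam)^-1 * ((1 - lam) * S) = 3 * S by field.
by lra.
Qed.

(** In [t1] steps the half-line is reached with probability at least 1/3 - 1/4 = 1/12 from anywhere,
    so the maximum of [u] is at most [t1] plus 11/12 of itself. *)
Lemma hitting_mean_le t1 u : mixed P p 4^-1 t1 -> green P pos w (fun=> 1) u ->
  forall x, u x <= 12 * t1%:R.
Proof.
move=> mx Gu x0; have u0 : forall x, 0 <= u x by exact: (green_ge0 rg sb wn _ Gu).
have [x _ xmax] : exists2 x, predT x & forall y, predT y -> u y <= u x.
  by case: (@arg_maxP _ _ _ x0 predT u isT) => q ? ?; exists q.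
apply: le_trans (xmax x0 isT) _.
have := mean_le_tail rg sb wn Gu t1 x (fun y => xmax y isT).
have tl : tail P pos w t1 x <= 11 / 12.
  pose A := [set y | (pos y < w)%N].
  have := @tail_le_iter R n P p lam pos rg w t1 x A 0%N 0.
  rewrite addn0 addr0 => tA; apply: le_trans (tA _ (lexx _)) _.
    by move=> y; rewrite inE -leqNgt => wy; rewrite tailL.
  have := mx x A; have : \sum_(y in A) p y <= 2 / 3; last lra.
  have : \sum_(y in A) p y + \sum_(y | (w <= pos y)%N) p y = 1.
    rewrite -(rg_p1 rg) [RHS](bigID (mem A))/=; congr (_ + _).
    by apply: eq_bigl => y; rewrite inE -leqNgt.
  move: wp; lra.
have := u0 x; have : 0 <= u x * (11 / 12 - tail P pos w t1 x).
  by rewrite mulr_ge0// subr_ge0.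
lra.
Qed.

(** The first term is the time needed outside the small set; [8 / (1 - b)] and [2 / a] count
    standard deviations below and above the mean, and [15 / c] bounds one of them. *)
Definition tail_const (a b : R) : R :=
  48 / ((1 - b) ^+ 2 * c) + (8 / (1 - b) + 2 / a) * (15 / c).

(** Chebyshev twice. Below the mean: by time [t0 + s1] the walk has hit with probability at least
    3(1 - b)/8, so [u x] cannot exceed that time by 8/(1 - b) deviations. Above the mean: after 2/a
    more deviations the survival probability is at most (a/2)^2. *)
Lemma hitting_tail_le a b t0 t1 : 0 < a < 1 -> 0 < b < 1 ->
  mixed P p b t0 -> mixed P p 4^-1 t1 ->
  forall t x, t0%:R + tail_const a b * (Num.sqrt (t1%:R * T) + T) <= t%:R ->
  tail P pos w t x <= a / 2.
Proof.
move=> /andP[a0 a1] /andP[b0 b1] mb m4 t x ht.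
have [u Gu] := green_exists rg sb wn (fun=> 1).
have [N GN] := green_exists rg sb wn u.
have u0 : forall x, 0 <= u x by exact: (green_ge0 rg sb wn _ Gu).
set sg := Num.sqrt _ + _ in ht.
have sg0 : 0 < sg by rewrite ltr_wpDl ?sqrtr_ge0// (lt_le_trans ltr01).
have sgT : T <= sg by rewrite lerDr sqrtr_ge0.
have tT0 : 0 <= t1%:R * T by rewrite mulr_ge0.
have sg2 : t1%:R * T <= sg ^+ 2.
  rewrite -[leLHS]sqr_sqrtr// ler_pXn2r ?nnegrE ?sqrtr_ge0 ?(ltW sg0)//.
  by rewrite /sg lerDl.
pose e := 1 - b; have e0 : 0 < e by rewrite subr_gt0.
have e1 : e < 1 by rewrite /e; lra.
(* The variance is at most (144/c^2 + 72/c) t1 T, and 144 + 72 <= 15^2. *)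
pose M := 15 / c * sg.
have M0 : 0 < M by rewrite mulr_gt0// divr_gt0.
have VM y : hitting_variance u N y <= M ^+ 2.
  apply: le_trans (hitting_variance_le rg sb wn tau0 tau_p Gu GN _ (hitting_mean_le m4 Gu)) _.
  rewrite -/c /M exprMn.
  apply: (@le_trans _ _ ((15 / c) ^+ 2 * (t1%:R * T))); last first.
    by rewrite ler_wpM2l// sqr_ge0.
  have -> : (15 / c) ^+ 2 * (t1%:R * T) = 225 * (c ^-1 ^+ 2) * (t1%:R * T).
    by rewrite exprMn; ring.
  have cc : c^-1 <= c^-1 ^+ 2.
    have ci : 1 <= c^-1 by rewrite invf_ge1.
    by rewrite expr2 ler_peMr// invr_ge0 (ltW c0).
  have -> : 2 * (2 * tau / c ^+ 2 + tau / c) * (12 * t1%:R) =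
     (144 * c^-1 ^+ 2 + 72 * c^-1) * (t1%:R * T) by rewrite /tau exprVn; ring.
  by rewrite ler_wpM2r//; have := sqr_ge0 c^-1; lra.
(* The end of the line away from the half-line, cut at mass e/2: at time [t0] the walk is there with
   probability at most b + e/2. *)
pose A := [set y | \sum_(z | (pos z <= pos y)%N) p z <= e / 2].
have pA : \sum_(y in A) p y <= e / 2.
  have [y0 hy0|no] := pickP [pred y | y \in A]; last first.
    by rewrite big_pred0 ?divr_ge0// ltW.
  case: (arg_maxnP pos hy0) => y yA ymax.
  have : \sum_(z | (pos z <= pos y)%N) p z <= e / 2 by move: yA; rewrite /= inE.
  apply: le_trans.
  rewrite big_mkcond [leRHS]big_mkcond; apply: ler_sum => z _.
  by case: ifP => [/ymax zy|_]; [rewrite ifT | case: ifP].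
(* Outside [A] the mean hitting time is at most 6T/(ec); Markov's inequality at time [X] turns this
   into e/8. *)
pose X := 48 * T / (e ^+ 2 * c); pose s1 := Num.truncn X.
have [c0' e0'] : 0 <= c /\ 0 <= e by rewrite !ltW.
have X0 : 0 <= X.
  by apply: divr_ge0; apply: mulr_ge0 => //; exact: sqr_ge0.
have /andP[s1X Xs1] := truncn_itv X0.
have uA y : y \notin A -> tail P pos w s1 y <= e / 8.
  rewrite inE -ltNge => hy; have [yw|yw] := ltnP (pos y) w; last first.
    by rewrite tailL// divr_ge0// ltW.
  have le1 : \sum_(z | (pos z < w)%N) p z <= 1.
    rewrite -(rg_p1 rg) [leRHS](bigID (fun z => pos z < w)%N)/= lerDl.
    by apply: sumr_ge0.
  have uy : c * u y <= 2 / e * tau.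
    apply: (green_window rg sb wn tau0 tau_p yw _ _ Gu) => //; rewrite ?leq_addr//.
      by rewrite divr_ge0// ltW.
    under eq_bigr do rewrite expr1n mulr1.
    apply: le_trans le1 _.
    have h : 1 <= (2 / e) ^+ 2 * (e / 2).
      have -> : (2 / e) ^+ 2 * (e / 2) = 2 / e by field; rewrite gt_eqF.
      by rewrite ler_pdivlMr// mul1r; lra.
    by apply: le_trans h _; apply: ler_wpM2l; rewrite ?sqr_ge0// ltW.
  have mk := tail_markov rg sb wn Gu s1 y.
  have s10 : 0 < s1.+1%:R :> R by rewrite ltr0Sn.
  rewrite -(ler_pM2l s10); apply: le_trans mk _.
  apply: (@le_trans _ _ (X * (e / 8))); last first.
    by apply: ler_wpM2r; [rewrite divr_ge0// ltW | exact: ltW].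
  rewrite -(ler_pM2l c0); apply: le_trans uy _.
  by rewrite le_eqVlt; apply/orP; left; apply/eqP; rewrite /X /tau; field; rewrite !gt_eqF.
have ux y : u y <= t0%:R + s1%:R + 8 / e * M.
  rewrite leNgt; apply/negP => lt.
  have e8 : 0 < 8 / e by rewrite divr_gt0.
  have tlt : (t0 + s1)%:R <= u y.
    by apply: ltW; apply: le_lt_trans lt; rewrite natrD lerDl mulr_ge0// ltW.
  have := tail_lower rg sb wn Gu GN tlt.
  set q := 1 - _ => low.
  have q0 : 0 <= q by rewrite subr_ge0 (tail_le1 pos rg).
  have le1 : q * (8 / e * M) ^+ 2 <= M ^+ 2.
    apply: le_trans (VM y); apply: le_trans low; rewrite ler_wpM2l//.
    have h8M : 0 <= 8 / e * M by rewrite mulr_ge0// ltW.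
    have hu : 8 / e * M <= u y - (t0 + s1)%:R by rewrite natrD; lra.
    by rewrite ler_pXn2r// nnegrE// (le_trans _ hu).
  have qe : q <= e / 8.
    move: le1; rewrite exprMn mulrA -[leRHS]mul1r ler_pM2r ?exprn_gt0// => le1.
    have e64 : q * (64 / e ^+ 2) <= 1.
      by move: le1; congr (_ <= _); congr (_ * _); field; rewrite gt_eqF.
    rewrite -ler_pdivlMr ?divr_gt0 ?exprn_gt0// in e64.
    apply: le_trans e64 _; rewrite mul1r invf_div.
    rewrite ler_pdivrMr// (_ : e / 8 * 64 = 8 * e); last by field.
    by rewrite expr2; apply: ler_wpM2r; [exact: ltW | lra].
  have := tail_le_iter rg t0 y uA (divr_ge0 (ltW e0) (ler0n _ 8)).
  have := mb y A; move: qe; rewrite /q -/c; move: pA; rewrite /e.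
  move: (iter _ _ _ _) (tail _ _ _ _ _) => i1 t2; lra.
have a2 : 0 < 2 / a by rewrite divr_gt0.
have utx : u x + 2 / a * M <= t%:R.
  apply: le_trans ht; apply: (@le_trans _ _ (t0%:R + X + 8 / e * M + 2 / a * M)).
    by rewrite lerD2r; apply: le_trans (ux x) _; rewrite lerD2r lerD2l.
  rewrite -!addrA lerD2l addrA.
  apply: (@le_trans _ _ (48 / (e ^+ 2 * c) * sg + (8 / e + 2 / a) * (15 / c) * sg)).
    rewrite -addrA lerD//.
      rewrite /X mulrAC; apply: ler_wpM2l => //; apply: divr_ge0 => //.
      by rewrite mulr_ge0// sqr_ge0.
    by rewrite /M le_eqVlt; apply/orP; left; apply/eqP; ring.
  by rewrite -mulrDl.
have := tail_upper rg sb wn Gu GN (t := t) (x := x).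
have h2 : 0 <= 2 / a * M by rewrite mulr_ge0// ltW.
have -> : (u x <= t%:R) = true by apply: le_trans utx; rewrite lerDl.
move=> /(_ isT) up.
have : tail P pos w t x * (2 / a * M) ^+ 2 <= M ^+ 2.
  apply: le_trans (VM x); apply: le_trans up.
  rewrite ler_wpM2l ?(tail_ge0 pos rg)//.
  have hu : 2 / a * M <= t%:R - u x by lra.
  by rewrite ler_pXn2r// nnegrE// (le_trans _ hu).
rewrite exprMn mulrA -[leRHS]mul1r ler_pM2r ?exprn_gt0// => le1.
rewrite -ler_pdivlMr ?exprn_gt0// in le1.
apply: le_trans le1 _; rewrite mul1r -exprVn invf_div exprMn exprVn.
by rewrite expr2; have := a0; nra.
Qed.

End HittingTail.

(** * Comparison of mixing times at two levels *)

Section Window.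
Variables (R : realType) (n : nat) (P : 'M[R]_n) (p : 'I_n -> R).
Variables (lam delta : R) (r : nat) (pos : 'I_n -> nat).
Hypothesis rg : reversible_gap P p lam.
Hypothesis sb : semi_bd P delta r pos.

Let P0 := rg_P0 rg.
Let P1 := rg_P1 rg.
Let p0 x : 0 <= p x := ltW (rg_p0 rg x).
Let T := (1 - lam)^-1.
Let l1 : 0 < 1 - lam. Proof. by rewrite subr_gt0 (rg_lam1 rg). Qed.
Let T1 : 1 <= T.
Proof. by rewrite invf_ge1// lerBlDr lerDl (rg_lam0 rg). Qed.

Let opposite (x : 'I_n) := (n.-1 - pos x)%N.

Lemma semi_bd_opposite : semi_bd P delta r opposite.
Proof.
have ltn x := sb_lt sb x.
split; rewrite /opposite.
- move=> x y /= xy; apply: (sb_inj sb); have := ltn x; have := ltn y.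
  by move: xy; clear; lia.
- by move=> x; have := ltn x; clear; lia.
- exact: (sb_delta0 sb).
- exact: (sb_delta1 sb).
- exact: (sb_r sb).
- move=> x y /(sb_far sb) []; have := ltn x; have := ltn y.
  by clear; lia.
- move=> x y xy; apply: (sb_near sb); have := ltn x; have := ltn y.
  by move: xy; clear; lia.
Qed.

Section Centered.
Variable A : {set 'I_n}.
Let f x : R := (x \in A)%:R - \sum_(y in A) p y.

Let pA : 0 <= \sum_(y in A) p y <= 1.
Proof.
rewrite sumr_ge0//= -(rg_p1 rg) [leRHS](bigID (mem A))/= lerDl.
by apply: sumr_ge0.
Qed.

Lemma centered_mean : \sum_x p x * f x = 0.
Proof.
under eq_bigr do rewrite mulrBr.
rewrite sumrB -mulr_suml (rg_p1 rg) mul1r [X in _ - X]big_mkcond.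
by rewrite -sumrB big1// => x _; case: (x \in A); rewrite ?mulr1 ?mulr0 subrr.
Qed.

Lemma centered_le1 x : `|f x| <= 1.
Proof.
move: pA => /andP[p1 p2]; rewrite ler_norml /f.
by case: (x \in A) => /=; lra.
Qed.

Lemma centered_norm : ip p f f <= 1.
Proof.
rewrite -(rg_p1 rg) /ip; apply: ler_sum => x _.
rewrite -[leRHS]mulr1 ler_wpM2l// -expr2 -real_normK ?num_real//.
by rewrite exprn_ile1// centered_le1.
Qed.

Lemma centered_iter t x : iter t (op P) f x =
  iter t (op P) (fun y => (y \in A)%:R) x - \sum_(y in A) p y.
Proof.
by rewrite /f iter_opB (iter_op_cst P1).
Qed.

Lemma centered_iter_le1 t x : iter t (op P) f x <= 1.
Proof.
elim: t x => [|t IH] x /=; first exact: le_trans (ler_norm _) (centered_le1 x).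
by apply: le_trans (op_le P0 IH x) _; rewrite op_cst.
Qed.

End Centered.

(** Half of [a] is spent on not reaching the good window by time [t], half on the error at its
    states. The maximal inequality bounds the bad mass by 12T/(a^2 s0), and [good_window] wants it
    below delta^r/(3r), whence 36. *)
Lemma mixed_of_tails a s0 t : 0 < a < 1 ->
  36 * r%:R * T / (a ^+ 2 * delta ^+ r) < s0%:R ->
  (forall w, (w < n)%N -> 3^-1 <= \sum_(x | (w <= pos x)%N) p x ->
    forall x, tail P pos w t x <= a / 2) ->
  (forall w, (w < n)%N -> 3^-1 <= \sum_(x | (w <= opposite x)%N) p x ->
    forall x, tail P opposite w t x <= a / 2) ->
  mixed P p a (s0 + t).
Proof.
move=> /andP[a0 a1] hs0 tl tr x A; rewrite -centered_iter.
set f := fun x => _.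
have d0 := sb_delta0 sb; have dr0 : 0 < delta ^+ r by rewrite exprn_gt0.
have r0 : 0 < r%:R :> R by rewrite ltr0n (sb_r sb).
have aa0 : 0 < a ^+ 2 by rewrite exprn_gt0.
have s0p : 0 < s0%:R :> R.
  apply: le_lt_trans hs0; rewrite divr_ge0// ?mulr_ge0 ?ltW//.
  by rewrite (lt_le_trans ltr01).
pose bad y := [exists k : 'I_t.+1, a / 2 < iter (s0 + k) (op P) f y].
have := @maximal_ineq R n P p P0 P1 p0 (rg_rev rg) (rg_lazy rg) lam
  (rg_lam0 rg) (rg_lam1 rg) (rg_gap rg) f s0 t ((a / 2) ^+ 2) bad
  (centered_mean A) (centered_norm A).
rewrite -(ltr0n R) => /(_ s0p) mx.
have {}mx : (a / 2) ^+ 2 * (\sum_(y | bad y) p y) <= 3 / (s0%:R * (1 - lam)).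
  apply: mx => y /existsP[k hk]; exists (s0 + k)%N; split.
  - exact: leq_addr.
  - by rewrite leq_add2l -ltnS.
  - have a2 : 0 < a / 2 by rewrite divr_gt0.
    by rewrite ler_pXn2r// ?nnegrE ?ltW// (lt_trans a2).
have small : r%:R * (\sum_(y | bad y) p y) * 3 < delta ^+ r.
  move: mx; set pb := \sum_(y | _) _ => mx.
  have mx' : a ^+ 2 * pb * s0%:R <= 12 * T.
    have := ler_wpM2r (ltW s0p) mx.
    have -> : 3 / (s0%:R * (1 - lam)) * s0%:R = 3 * T.
      by rewrite /T; field; rewrite !gt_eqF.
    by rewrite exprMn => h; lra.
  have : 36 * r%:R * T < s0%:R * (a ^+ 2 * delta ^+ r).
    by rewrite -ltr_pdivrMr// mulr_gt0.
  move=> h; rewrite -(ltr_pM2l s0p) -(ltr_pM2l aa0).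
  apply: le_lt_trans (_ : 36 * r%:R * T < _); last by apply: lt_le_trans h _; rewrite mulrCA.
  have := ler_wpM2l (ltW r0) mx'; lra.
have [w [wn good wl wr]] := good_window rg sb small.
have a20 : 0 <= a / 2 by rewrite divr_ge0// ltW.
have nbad k y : (k <= t)%N -> ~~ bad y -> iter (s0 + k) (op P) f y <= a / 2.
  rewrite /bad negb_exists -ltnS => kt /forallP /(_ (Ordinal kt)).
  by rewrite -leNgt.
have half v : v <= a / 2 -> a / 2 + v <= a.
  by move=> ?; lra.
have [xw|xw] := ltnP (pos x) (w + r).
  apply: le_trans (tail_dominates rg sb a20 _ (centered_iter_le1 A s0) (leqnn t) xw) _.
    by move=> k y kt wy; apply: nbad => //; exact: good.
  exact/half/tl.
have xn := sb_lt sb x; have r0' := sb_r sb.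
(* From the right of the window the same argument runs in reversed order: the target half-line is
   [pos y < w + r], and its first [r] states are again the window. *)
pose w' := (n - (w + r))%N.
have oppE y : (w' <= opposite y)%N = (pos y < w + r)%N.
  have := sb_lt sb y; rewrite /opposite /w'; move: xw xn r0'; clear; lia.
have w'n : (w' < n)%N by rewrite /w'; move: r0' xn; clear; lia.
have xw' : (opposite x < w' + r)%N.
  by rewrite /opposite /w'; move: xw xn r0'; clear; lia.
apply: le_trans (tail_dominates rg semi_bd_opposite a20 _ (centered_iter_le1 A s0) (leqnn t) xw') _.
  move=> k y kt /andP[wy yw]; apply: nbad => //; apply: good.
  rewrite oppE in wy; rewrite wy andbT.
  have := sb_lt sb y; move: yw; rewrite /opposite /w'; move: xw xn r0'; clear; lia.
by apply/half/tr => //; under eq_bigl do rewrite oppE.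
Qed.

(** The first term accounts for the burn-in time of [mixed_of_tails], and 2 for rounding two times
    up to integers. *)
Definition window_const (a b : R) : R :=
  36 * r%:R / (a ^+ 2 * delta ^+ r) + tail_const delta r a b + 2.

Lemma window_bound a b t0 t1 : 0 < a < 1 -> 0 < b < 1 ->
  mixed P p b t0 -> mixed P p 4^-1 t1 ->
  exists t, mixed P p a t /\
    t%:R <= t0%:R + window_const a b * (Num.sqrt (t1%:R * T) + T).
Proof.
move=> a01 b01 mb m4; set sg := Num.sqrt _ + _.
have sgT : T <= sg by rewrite lerDr sqrtr_ge0.
have sg1 : 1 <= sg by exact: le_trans sgT.
have T0 : 0 <= T by exact: le_trans T1.
have dr0 : 0 < delta ^+ r by rewrite exprn_gt0// (sb_delta0 sb).
move: (a01) (b01) => /andP[a0 a1] /andP[b0 b1].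
pose Y := 36 * r%:R * T / (a ^+ 2 * delta ^+ r); pose Z := t0%:R + tail_const delta r a b * sg.
have q0 : 0 <= 36 * r%:R / (a ^+ 2 * delta ^+ r).
  by rewrite divr_ge0 ?mulr_ge0 ?sqr_ge0// ltW.
have YE : Y = 36 * r%:R / (a ^+ 2 * delta ^+ r) * T by rewrite /Y mulrAC.
have Y0 : 0 <= Y by rewrite YE mulr_ge0.
have c0 : 0 < delta ^+ (r + r) by rewrite exprn_gt0// (sb_delta0 sb).
have tc0 : 0 <= tail_const delta r a b.
  rewrite /tail_const addr_ge0//.
    apply: divr_ge0 => //; apply: mulr_ge0; [exact: sqr_ge0 | exact: ltW].
  by rewrite mulr_ge0 ?addr_ge0 ?divr_ge0 ?subr_ge0// ltW.
have Z0 : 0 <= Z by rewrite addr_ge0// mulr_ge0// (le_trans ler01).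
have /andP[y1 y2] := truncn_itv Y0; have /andP[z1 z2] := truncn_itv Z0.
exists ((Num.truncn Y).+1 + (Num.truncn Z).+1)%N; split.
  apply: mixed_of_tails => // w wn wp x.
    by apply: (hitting_tail_le rg sb wn wp a01 b01 mb m4); exact: ltW.
  by apply: (hitting_tail_le rg semi_bd_opposite wn wp a01 b01 mb m4); exact: ltW.
rewrite natrD -!natr1 /window_const -/sg.
have Yq : Y <= 36 * r%:R / (a ^+ 2 * delta ^+ r) * sg by rewrite YE ler_wpM2l.
have sum_le (q tc u v1 v2 s y : R) : 1 <= s -> y <= q * s -> v1 <= y ->
    v2 <= u + tc * s -> v1 + 1 + (v2 + 1) <= u + (q + tc + 2) * s.
  by move=> *; lra.
exact: (sum_le _ _ _ _ _ _ Y).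
Qed.

(** Ensures that mixing times are infima of nonempty sets. The sum [S] serves as a common bound for
    T/(p(x) a^2) over all states. *)
Lemma mixed_exists a : 0 < a -> exists t, mixed P p a t.
Proof.
move=> a0; pose S := \sum_x T / (p x * a ^+ 2).
have T0 : 0 <= T by exact: le_trans T1.
have term0 x : 0 <= T / (p x * a ^+ 2).
  by rewrite divr_ge0// mulr_ge0// sqr_ge0.
have S0 : 0 <= S by apply: sumr_ge0.
have /andP[_ hS] := truncn_itv S0; set t := _.+1 in hS.
exists t => x A; rewrite -centered_iter leNgt; apply/negP.
set f := fun x => _; set v := iter _ _ _ _ => av.
have := decay P0 P1 p0 (rg_rev rg) (rg_lazy rg) (rg_lam0 rg) (rg_gap rg) t
  (centered_mean A).
set f' := iter t (op P) _ => dec.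
have lamt1 : lam ^+ t <= 1 by rewrite exprn_ile1 ?(rg_lam0 rg)// ltW// (rg_lam1 rg).
have lamt0 : 0 <= lam ^+ t by rewrite exprn_ge0// (rg_lam0 rg).
have up : p x * a ^+ 2 < lam ^+ t.
  apply: (@lt_le_trans _ _ (p x * f' x ^+ 2)).
    rewrite ltr_pM2l ?(rg_p0 rg)// ltr_pXn2r// nnegrE ltW// (lt_trans a0)//.
  apply: (@le_trans _ _ (ip p f' f')).
    rewrite /ip (bigD1 x)//= -expr2 lerDl; apply: sumr_ge0 => y _.
    by rewrite mulr_ge0// -expr2 sqr_ge0.
  apply: le_trans dec _; apply: (@le_trans _ _ ((lam ^+ t) ^+ 2 * 1)).
    by apply: ler_wpM2l; [exact: sqr_ge0 | exact: centered_norm].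
  by rewrite mulr1 expr2 ler_piMl.
have := lam_exp_le (rg_lam0 rg) (rg_lam1 rg) t.
have px0 : 0 < p x * a ^+ 2 by rewrite mulr_gt0 ?(rg_p0 rg)// exprn_gt0.
have : T / (p x * a ^+ 2) < t%:R.
  by apply: le_lt_trans hS; rewrite /S (bigD1 x)//= lerDl sumr_ge0.
rewrite ltr_pdivrMr// /T -[X in X < _]mul1r ltr_pdivrMr// => h1 h2.
have t0 : 0 < t%:R :> R by rewrite ltr0Sn.
have : t%:R * (1 - lam) * (p x * a ^+ 2) < t%:R * (1 - lam) * lam ^+ t.
  by rewrite ltr_pM2l// mulr_gt0.
lra.
Qed.

End Window.

(** * Spectral gap *)

Local Open Scope classical_set_scope.

(** * Maximum of the Rayleigh quotient on mean-zero functions *)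

Section Rayleigh.
Variables (R : realType) (n : nat) (P : 'M[R]_n) (p : 'I_n -> R).
Hypothesis n1 : (1 < n)%N.
Hypothesis p0 : forall x, 0 < p x.

Let ip_gt0 (f : 'I_n -> R) x : f x != 0 -> 0 < ip p f f.
Proof.
move=> fx; rewrite /ip (bigD1 x)//= ltr_pwDl//.
  by rewrite mulr_gt0// -expr2 exprn_even_gt0.
by apply: sumr_ge0 => y _; rewrite mulr_ge0 ?(ltW (p0 _))// -expr2 sqr_ge0.
Qed.

Lemma ipZ (a : R) (f g : 'I_n -> R) :
  ip p (fun x => a * f x) (fun x => a * g x) = a ^+ 2 * ip p f g.
Proof. by rewrite /ip mulr_sumr; apply: eq_bigr => x _; ring. Qed.

Lemma opZ (a : R) (f : 'I_n -> R) :
  op P (fun x => a * f x) = fun x => a * op P f x.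
Proof.
by apply/funext => x; rewrite /op mulr_sumr; apply: eq_bigr => y _; ring.
Qed.

Let normalize (f : 'I_n -> R) x : f x != 0 ->
  exists2 a, 0 < a & ip p (fun y => a * f y) (fun y => a * f y) = 1.
Proof.
move=> /ip_gt0 f0; exists (Num.sqrt (ip p f f))^-1; first by rewrite invr_gt0 sqrtr_gt0.
by rewrite ipZ exprVn sqr_sqrtr ?ltW// mulVf// gt_eqF.
Qed.

Lemma sum_continuous (T : topologicalType) (I : finType) (F : I -> T -> R) :
  (forall i, continuous (F i)) -> continuous (fun x => \sum_i F i x).
Proof.
move=> cF x; have -> : (fun x => \sum_i F i x) = \sum_i F i.
  by apply/funext => y; rewrite fct_sumE.
elim/big_ind: _ => [|f g cf cg|i _]; last exact: cF.
  exact: cst_continuous.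
exact: continuousD.
Qed.

Lemma rayleigh_max : exists v : 'I_n -> R, [/\ \sum_x p x * v x = 0, ip p v v = 1 &
  forall f, \sum_x p x * f x = 0 -> ip p (op P f) f <= ip p (op P v) v * ip p f f].
Proof.
pose K := [set v : 'rV[R]_n | \sum_x p x * v 0 x = 0 /\ ip p (v 0) (v 0) = 1].
have coord x : continuous (fun v : 'rV[R]_n => v 0 x) by exact: coord_continuous.
have mulc (f g : 'rV[R]_n -> R) : continuous f -> continuous g ->
    continuous (fun v => f v * g v).
  by move=> cf cg v; apply: continuousM; [exact: cf | exact: cg].
have cc (a : R) : continuous (fun _ : 'rV[R]_n => a) by exact: cst_continuous.
have cmean : continuous (fun v : 'rV[R]_n => \sum_x p x * v 0 x).
  by apply: sum_continuous => x; apply: (mulc _ _).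
have cnorm : continuous (fun v : 'rV[R]_n => ip p (v 0) (v 0)).
  by apply: sum_continuous => x; apply: (mulc _ _) => //; apply: (mulc _ _).
have cop : continuous (fun v : 'rV[R]_n => ip p (op P (v 0)) (v 0)).
  apply: sum_continuous => x; apply: (mulc _ _) => //; apply: (mulc _ _) => //.
  by apply: sum_continuous => y; apply: (mulc _ _).
have mem_K (f : 'I_n -> R) x : \sum_x p x * f x = 0 -> f x != 0 ->
    exists2 a, 0 < a & K (\row_y (a * f y)).
  move=> f0 fx; have [a a0 nf] := normalize fx; exists a => //; split.
    under eq_bigr do rewrite mxE mulrCA.
    by rewrite -mulr_sumr f0 mulr0.
  rewrite -[RHS]nf; congr (ip p _ _); apply/funext => y; exact: mxE.
have K0 : K !=set0.
  pose i : 'I_n := Ordinal (ltnW n1); pose j : 'I_n := Ordinal n1.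
  pose f x := (x == i)%:R / p i - (x == j)%:R / p j.
  have f0 : \sum_x p x * f x = 0.
    under eq_bigr do rewrite mulrBr.
    rewrite sumrB (bigD1 i)//= big1 ?addr0; last first.
      by move=> x /negPf ->; rewrite mul0r mulr0.
    rewrite (bigD1 j)//= big1 ?addr0; last first.
      by move=> x /negPf ->; rewrite mul0r mulr0.
    by rewrite ?eqxx ?mulr1n !mul1r !divff ?gt_eqF// subrr.
  have fi : f i != 0.
    have ij : (i == j) = false by [].
    by rewrite /f ij eqxx mul0r subr0 mul1r invr_neq0// gt_eqF.
  by have [a _ Ka] := mem_K f i f0 fi; exists (\row_y (a * f y)).
have Kcl : closed K.
  apply: closedI.
    exact: (preimage_closed (fun v _ => cmean v) (@closed_eq R 0)).
  exact: (preimage_closed (fun v _ => cnorm v) (@closed_eq R 1)).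
have Kcpt : compact K.
  (* Unit norm gives v_i^2 <= 1/p_i; the side 1/p_i + 1 is a bound for |v_i| that avoids a square
     root. *)
  have box : compact [set v : 'rV[R]_n |
      forall i, `[- ((p i)^-1 + 1), (p i)^-1 + 1]%classic (v ord0 i)].
    apply: (@rV_compact _ _ (fun i => `[- ((p i)^-1 + 1), (p i)^-1 + 1]%classic)).
    by move=> i; exact: segment_compact.
  apply: subclosed_compact Kcl box _ => v [_ v1] i /=.
  rewrite in_itv /= -ler_norml.
  have pv : p i * v 0 i ^+ 2 <= 1.
    rewrite -v1 /ip (bigD1 i)//= -expr2 lerDl; apply: sumr_ge0 => y _.
    by rewrite mulr_ge0 ?(ltW (p0 _))// -expr2 sqr_ge0.
  have q0 : 0 < (p i)^-1 by rewrite invr_gt0.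
  rewrite -(@ler_pXn2r _ 2)// ?nnegrE ?normr_ge0//; last by lra.
  rewrite real_normK ?num_real//; apply: (@le_trans _ _ (p i)^-1).
    by rewrite -[leRHS]mul1r ler_pdivlMr// mulrC.
  by move: (p i)^-1 q0 => q q0; nra.
have [v vK vmax] := EVT_max_rV K0 Kcpt (continuous_subspaceT cop).
have [v0 v1] := set_mem vK; exists (v 0); split=> // f f0.
have [x fx|nf] := pickP [pred x | f x != 0]; last first.
  have -> : f = fun=> 0 by apply/funext => x; have := nf x; move=> /negbFE/eqP.
  have z g : ip p g (fun=> 0) = 0 by rewrite /ip big1// => y _; rewrite !mulr0.
  by rewrite !z mulr0.
have [a a0 Ka] := mem_K f x f0 fx.
have := vmax _ (mem_set Ka); have := Ka.2.
have -> : (\row_y (a * f y)) 0 = (fun y => a * f y) by apply/funext => y; rewrite mxE.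
rewrite opZ !ipZ => na; rewrite -[X in _ <= X -> _]mulr1 -na mulrCA.
by rewrite ler_pM2l// exprn_gt0.
Qed.

End Rayleigh.

(** * The eigenvalue [lambda2] as a variational gap *)

Section SpectralGap.
Variables (R : realType) (n : nat) (P : 'M[R]_n) (pi : 'rV[R]_n) (delta : R).
Hypothesis n1 : (1 < n)%N.
Hypothesis sP : stochastic P.
Hypothesis st : stationary P pi.
Hypothesis lz : is_lazy P.
Hypothesis rv : reversible P pi.
Hypothesis d0 : 0 < delta.
Hypothesis near : forall i j : 'I_n, `|i%:R - j%:R : R| = 1 -> delta <= P i j.

Let p x := pi 0 x.
Let P0 := sP.1.
Let P1 := sP.2.
Let pp0 : forall x, 0 <= p x := st.1.1.
Let pp1 : \sum_x p x = 1 := st.1.2.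

Lemma near_succ (x y : 'I_n) : val y = x.+1 -> delta <= P x y /\ delta <= P y x.
Proof.
move=> xy; have e : (y%:R - x%:R : R) = 1 by rewrite [val y]xy -natr1; ring.
by split; apply: near; [rewrite distrC|]; rewrite e normr1.
Qed.

Lemma neighbours_ind (Q : 'I_n -> Prop) :
  (forall x y : 'I_n, val y = x.+1 -> Q x <-> Q y) -> forall x y, Q x -> Q y.
Proof.
move=> step; suff up k (x y : 'I_n) : val y = (x + k)%N -> Q x <-> Q y.
  move=> x y; have [xy|yx] := leqP x y.
    by have [+ _] := up (y - x)%N x y (esym (subnKC xy)).
  by have [_] := up (x - y)%N y x (esym (subnKC (ltnW yx))).
elim: k y => [|k IH] y xy; first by have -> : y = x by apply/val_inj; rewrite /= xy addn0.
have kn : (x + k < n)%N by apply: leq_ltn_trans (ltn_ord y); rewrite [val y]xy addnS.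
have zy : val y = (Ordinal kn).+1 by rewrite xy addnS.
by split => [/(IH (Ordinal kn) erefl)/(step _ _ zy)|/(step _ _ zy)/(IH (Ordinal kn) erefl)].
Qed.

Lemma stationary_gt0 x : 0 < p x.
Proof.
rewrite lt_def pp0 andbT; apply/eqP => px.
have all0 y : p y = 0.
  apply: (@neighbours_ind (fun z => p z = 0) _ x y px) => a b /near_succ[ab ba].
  have := rv a b; rewrite -/(p a) -/(p b) => e; split=> z; move: e; rewrite z mul0r.
    by move/esym/eqP; rewrite mulf_eq0 (gt_eqF (lt_le_trans d0 ba)) orbF => /eqP.
  by move/eqP; rewrite mulf_eq0 (gt_eqF (lt_le_trans d0 ab)) orbF => /eqP.
by have /eqP := pp1; rewrite big1// eq_sym oner_eq0.
Qed.

(** [eigenvalue] refers to row vectors; dividing by [p] makes a right eigenvector by reversibility,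
    and invariance of the mean forces mean zero when [a] is not 1. *)
Lemma eigen_rayleigh (a : R) : eigenvalue P a -> a != 1 ->
  exists f : 'I_n -> R, [/\ \sum_x p x * f x = 0, op P f = (fun x => a * f x) & 0 < ip p f f].
Proof.
move=> /eigenvalueP[w wP w0] a1; pose f x := w 0 x / p x.
have pf x : p x * f x = w 0 x by rewrite mulrC divfK// gt_eqF// stationary_gt0.
have fP : op P f = fun x => a * f x.
  apply/funext => x; have p0 : p x != 0 by rewrite gt_eqF// stationary_gt0.
  apply: (mulfI p0); rewrite mulrCA pf /op mulr_sumr.
  have /rowP/(_ x) := wP; rewrite !mxE => <-; apply: eq_bigr => y _.
  by rewrite mulrA [p x * _]rv mulrAC pf.
exists f; split=> //.
  have := mean_op P1 rv f; rewrite fP; under eq_bigr do rewrite mulrCA.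
  rewrite -mulr_sumr => /eqP; rewrite -subr_eq0 -{2}[\sum_x _]mul1r -mulrBl mulf_eq0.
  by rewrite subr_eq0 (negPf a1) => /eqP.
have [x wx] : exists x, w 0 x != 0.
  by move/rV0Pn: w0.
have fx : f x != 0 by rewrite mulf_neq0// invr_neq0// gt_eqF// stationary_gt0.
rewrite /ip (bigD1 x)//= ltr_pwDl//.
  by rewrite mulr_gt0 ?stationary_gt0// -expr2 exprn_even_gt0.
by apply: sumr_ge0 => y _; rewrite mulr_ge0 ?pp0// -expr2 sqr_ge0.
Qed.

Lemma lambda2_gap : reversible_gap P p (lambda2 P).
Proof.
have p0 := stationary_gt0.
have [v [v0 v1 vmax]] := rayleigh_max P n1 p0.
set rho := ip p (op P v) v in vmax.
pose g x := rho * v x - op P v x.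
have gE : (fun x => rho * v x + (-1) * op P v x) = g.
  by apply/funext => x; rewrite /g; ring.
have g0 : \sum_x p x * g x = 0.
  under eq_bigr do rewrite mulrBr mulrCA.
  by rewrite sumrB -mulr_sumr (mean_op P1 rv) v0 mulr0 subrr.
(* The form rho <f,f> - <Pf,f> is nonnegative on mean-zero functions and zero at the maximiser [v],
   so its pairing of [v] with [g] vanishes; this pairing is the squared norm of [g]. *)
have gg : ip p g g = 0.
  have : (rho * ip p v g - ip p (op P v) g) ^+ 2 <=
      0 * (rho * ip p g g - ip p (op P g) g).
    apply: discriminant_le => t.
    have m0 : \sum_x p x * (1 * v x + t * g x) = 0.
      under eq_bigr do rewrite mulrDr mul1r mulrCA.
      by rewrite big_split /= -mulr_sumr g0 v0 mulr0 addr0.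
    by have := vmax _ m0; rewrite ip_quadratic (ip_op_quadratic rv) -/rho v1; lra.
  have -> : rho * ip p v g - ip p (op P v) g = ip p g g.
    by rewrite -{3}gE ip_comb; ring.
  by rewrite mul0r => h; apply/eqP; rewrite -sqrf_eq0 eq_le h sqr_ge0.
have vE x : op P v x = rho * v x.
  apply/eqP; rewrite eq_sym -subr_eq0 -/(g x) -sqrf_eq0.
  move/eqP: gg; rewrite /ip psumr_eq0; last first.
    by move=> y _; rewrite mulr_ge0 ?pp0// -expr2 sqr_ge0.
  by move/allP/(_ x (mem_index_enum _)); rewrite mulf_eq0 gt_eqF//= -expr2.
have rho0 : 0 <= rho by apply: (ip_op_ge0 P0 P1 pp0 rv lz).
have rho1 : rho <= 1 by rewrite -v1; apply: (ip_op_le P0 P1 pp0 rv).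
(* For [rho = 1] the Dirichlet form of [v] would vanish, making [v] constant along the line, against
   mean zero and unit norm. *)
have rhoN1 : rho != 1.
  apply/eqP => e; have := dirichletE P1 rv v.
  rewrite v1 -/rho e subrr mulr0 => /eqP.
  rewrite psumr_eq0; last first.
    by move=> x _; apply: sumr_ge0 => y _; rewrite mulr_ge0 ?sqr_ge0// mulr_ge0 ?pp0 ?P0.
  move=> /allP d.
  have vxy x y : P x y != 0 -> v x = v y.
    move=> Pxy; have := d x (mem_index_enum _); rewrite psumr_eq0; last first.
      by move=> z _; rewrite mulr_ge0 ?sqr_ge0// mulr_ge0 ?pp0 ?P0.
    move=> /allP/(_ y (mem_index_enum _)).
    by rewrite mulf_eq0 sqrf_eq0 mulf_eq0 (gt_eqF (p0 x)) (negPf Pxy) /= subr_eq0 => /eqP.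
  pose x0 : 'I_n := Ordinal (ltnW n1).
  have vc y : v y = v x0.
    apply: (@neighbours_ind (fun z => v z = v x0) _ x0 y erefl).
    by move=> a b /near_succ[ab _]; rewrite (vxy a b)// gt_eqF// (lt_le_trans d0).
  have vz : v x0 = 0.
    by rewrite -v0; under eq_bigr do rewrite vc; rewrite -mulr_suml pp1 mul1r.
  have := v1; rewrite /ip big1 => [/esym/eqP|x _]; first by rewrite oner_eq0.
  by rewrite vc vz !mulr0.
have gap f : \sum_x p x * f x = 0 -> ip p (op P f) f <= rho * ip p f f by exact: vmax.
have l2 : lambda2 P = rho.
  have Srho : [set a | eigenvalue P a /\ a != 1] rho.
    split=> //; apply/eigenvalueP; exists (\row_x (p x * v x)).
      apply/rowP => y; rewrite !mxE -[in RHS]mulrCA -vE /op mulr_sumr.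
      by apply: eq_bigr => x _; rewrite mxE mulrAC [p x * _]rv mulrA.
    apply/eqP => /rowP z; have := v1; rewrite /ip big1 => [/esym/eqP|x _].
      by rewrite oner_eq0.
    by have := z x; rewrite !mxE mulrA => ->; rewrite mul0r.
  have ubS : ubound [set a | eigenvalue P a /\ a != 1] rho.
    move=> a [ea a1]; have [f [f0 fE ff]] := eigen_rayleigh ea a1.
    have := gap f f0; rewrite fE.
    have -> : ip p (fun x => a * f x) f = a * ip p f f.
      by rewrite /ip mulr_sumr; apply: eq_bigr => x _; ring.
    by rewrite ler_pM2r.
  apply: le_anti; rewrite ge_sup//=; last by exists rho.
  by apply: ub_le_sup => //; exists rho.
by rewrite l2; split=> //; rewrite lt_def eq_sym rhoN1.
Qed.

End SpectralGap.

(** * Cutoff *)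

Section MixingTime.
Variables (R : realType) (n : nat) (P : 'M[R]_n) (pi : 'rV[R]_n).

Lemma iter_opE t f x : iter t (op P) f x = \sum_y (P ^+ t) x y * f y.
Proof.
elim: t f x => [|t IH] f x.
  rewrite /= expr0 (bigD1 x)//= big1 ?addr0.
    by rewrite mxE eqxx mul1r.
  by move=> y /negPf yx; rewrite mxE eq_sym yx mul0r.
rewrite iterSr IH exprSr; under eq_bigr do rewrite /op mulr_sumr.
rewrite exchange_big; apply: eq_bigr => y _.
by rewrite -mulmxE mxE mulr_suml; apply: eq_bigr => z _; rewrite mulrA.
Qed.

Lemma tv_max_le a t : 0 <= a -> stochastic P -> is_distribution pi ->
  (tv_max P pi t <= a) <-> mixed P (pi 0) a t.
Proof.
move=> a0 [P0 P1] [pi0 pi1].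
pose d x y := (P ^+ t) x y - pi 0 y.
have d0 x : \sum_y d x y = 0.
  rewrite sumrB pi1; apply/eqP; rewrite subr_eq0; apply/eqP.
  have := iter_opE t (fun=> 1) x; under [in RHS]eq_bigr do rewrite mulr1.
  by rewrite (iter_op_cst P1) => <-.
have dA x (A : {set 'I_n}) : iter t (op P) (fun y => (y \in A)%:R) x -
    \sum_(y in A) pi 0 y = \sum_(y in A) d x y.
  rewrite sumrB iter_opE; congr (_ - _); rewrite [RHS]big_mkcond.
  by apply: eq_bigr => y _; case: (y \in A); rewrite ?mulr1 ?mulr0.
have tvE x : tv_dist (row x (P ^+ t)) pi = 2^-1 * \sum_y `|d x y|.
  by congr (_ * _); apply: eq_bigr => y _; rewrite mxE.
split=> [tv x A|mx].
  rewrite dA; apply: (@le_trans _ _ (tv_dist (row x (P ^+ t)) pi)).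
    have := d0 x; rewrite tvE !(bigID (mem A) predT)/=.
    have : \sum_(y in A) d x y <= \sum_(y in A) `|d x y|.
      by apply: ler_sum => y _; exact: ler_norm.
    have : - (\sum_(y | y \notin A) d x y) <= \sum_(y | y \notin A) `|d x y|.
      by rewrite -sumrN; apply: ler_sum => y _; rewrite -normrN ler_norm.
    lra.
  by apply: le_trans tv; exact: (le_bigmax_cond _ _ (isT : predT x)).
(* As [d x] sums to zero, the set where it is nonnegative realises the total variation distance. *)
apply: bigmax_le => // x _; pose A : {set 'I_n} := [set y | 0 <= d x y]%SET.
apply: le_trans (mx x A); rewrite dA tvE; have := d0 x.
rewrite !(bigID (mem A) predT)/=.
have -> : \sum_(y in A) `|d x y| = \sum_(y in A) d x y.
  by apply: eq_bigr => y; rewrite inE => /ger0_norm.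
have -> : \sum_(y | y \notin A) `|d x y| = - \sum_(y | y \notin A) d x y.
  by rewrite -sumrN; apply: eq_bigr => y; rewrite inE -ltNge => /ltr0_norm.
lra.
Qed.

Variables (delta r : R).
Hypothesis d0 : 0 < delta.
Hypothesis sbd : SBD_chain delta r P pi.

Lemma SBD_reversible_gap : reversible_gap P (pi 0) (lambda2 P).
Proof.
have [[n1 sP st lz rv] [_ near]] := sbd.
exact: (lambda2_gap n1 sP st lz rv d0 near).
Qed.

(** The successor makes the integer range exceed the real [r] and be positive. *)
Lemma SBD_semi_bd : semi_bd P delta (Num.truncn r).+1 (@nat_of_ord n).
Proof.
have [[n1 [P0 P1] st lz rv] [far near]] := sbd.
have near' := near_succ near.
split=> //.
- exact: val_inj.
- have [d1 _] := near' (Ordinal (ltnW n1)) (Ordinal n1) erefl.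
  apply: (le_trans d1); rewrite -(P1 (Ordinal (ltnW n1))) (bigD1 (Ordinal n1))//= lerDl.
  by apply: sumr_ge0.
- move=> x y Pxy.
  have xyr : `|x%:R - y%:R : R| <= r.
    by rewrite leNgt; apply/negP => /far e; rewrite e eqxx in Pxy.
  have r0 : 0 <= r by exact: le_trans (normr_ge0 _) xyr.
  have /andP[_ rt] := truncn_itv r0.
  move: (le_lt_trans xyr rt); rewrite ltr_norml => /andP[h1 h2].
  by split; rewrite ltnW// -(ltr_nat R) natrD; lra.
- move=> x y [xy|yx]; first by have [] := near' x y xy.
  by have [] := near' y x yx.
Qed.

Lemma trel_ge1 : 1 <= trel P.
Proof.
have rg := SBD_reversible_gap.
by rewrite invf_ge1 ?subr_gt0 ?(rg_lam1 rg)// lerBlDr lerDl (rg_lam0 rg).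
Qed.

Lemma tmix_attained a : 0 < a -> exists t, [/\ tmix P pi a = t%:R,
  mixed P (pi 0) a t & forall s, mixed P (pi 0) a s -> (t <= s)%N].
Proof.
move=> a0; have [[_ sP [di _] _ _] _] := sbd.
have tvE t : (tv_max P pi t <= a) <-> mixed P (pi 0) a t.
  by apply: tv_max_le => //; exact: ltW.
have ex : exists t, tv_max P pi t <= a.
  by have [t /tvE] := mixed_exists SBD_reversible_gap a0; exists t.
case: (ex_minnP ex) => t ta tmin; exists t; split; last by move=> s /tvE/tmin.
  rewrite /tmix; apply: le_anti; apply/andP; split.
    by apply: ge_inf; [exists 0 => _ [s _ <-] | exists t].
  apply: lb_le_inf; first by exists t%:R; exists t.
  by move=> _ [s sa <-]; rewrite ler_nat tmin.
exact/tvE.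
Qed.

(** Being mixed at time 0 would give each of at least two states mass at least 3/4. *)
Lemma tmix_ge1 : 1 <= tmix P pi 4^-1.
Proof.
have q0 : 0 < 4^-1 :> R by rewrite invr_gt0.
have [t [-> mt _]] := tmix_attained q0; case: t mt => [mt|t _]; last by rewrite ler1n.
have [[n1 _ [[pi0 pi1] _] _ _] _] := sbd; exfalso.
have big (x : 'I_n) : 3 / 4 <= pi 0 x.
  by have := mt x [set x]%SET; rewrite big_set1 /= finset.in_set1 eqxx /=; lra.
move: pi1; rewrite (bigD1 (Ordinal n1))//= (bigD1 (Ordinal (ltnW n1)))//=.
have := big (Ordinal n1); have := big (Ordinal (ltnW n1)).
have : 0 <= \sum_(i < n | (i != Ordinal n1) && (i != Ordinal (ltnW n1))) pi 0 i.
  by apply: sumr_ge0.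
lra.
Qed.

(** No order between [a] and [b] is assumed, so exchanging them bounds the absolute difference. *)
Lemma tmix_diff a b : 0 < a < 1 -> 0 < b < 1 ->
  tmix P pi a - tmix P pi b <= window_const delta (Num.truncn r).+1 a b *
    (Num.sqrt (tmix P pi 4^-1 * trel P) + trel P).
Proof.
move=> a01 b01; have [/andP[a0 _] /andP[b0 _]] := (a01, b01).
have q0 : 0 < 4^-1 :> R by rewrite invr_gt0.
have [ta [-> _ tamin]] := tmix_attained a0; have [tb [-> mb _]] := tmix_attained b0.
have [t4 [-> m4 _]] := tmix_attained q0.
have [t [mt tle]] := window_bound SBD_reversible_gap SBD_semi_bd a01 b01 mb m4.
by rewrite lerBlDl; apply: le_trans tle; rewrite ler_nat tamin.
Qed.

End MixingTime.

(** * Sequences of chains *)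

Section Cutoff.
Variables (R : realType) (delta r : R) (n : nat -> nat).
Variables (P : forall k : nat, 'M[R]_(n k)) (pi : forall k : nat, 'rV[R]_(n k)).
Hypothesis d0 : 0 < delta.
Hypothesis sbd : forall k, SBD_chain delta r (P k) (pi k).
Hypothesis prod : product_condition P pi.

Let tm k := tmix (P k) (pi k) 4^-1.
Let w k := Num.sqrt (tm k * trel (P k)).

Let tm1 k : 1 <= tm k. Proof. exact: tmix_ge1 d0 (sbd k). Qed.
Let T1 k : 1 <= trel (P k). Proof. exact: trel_ge1 d0 (sbd k). Qed.
Let tm0 k : 0 <= tm k. Proof. exact: le_trans (tm1 k). Qed.
Let T0 k : 0 <= trel (P k). Proof. exact: le_trans (T1 k). Qed.
Let w0 k : 0 <= w k. Proof. exact: sqrtr_ge0. Qed.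
Let w2 k : w k ^+ 2 = tm k * trel (P k). Proof. by rewrite sqr_sqrtr// mulr_ge0. Qed.

Lemma trel_small (e : R) : 0 < e -> \forall k \near \oo, trel (P k) <= e * tm k.
Proof.
move=> e0; have /eqoP/(_ e e0) := prod; apply: filterS => k.
by rewrite (ger0_norm (T0 k)) (ger0_norm (tm0 k)).
Qed.

Lemma window_small (e : R) : 0 < e -> \forall k \near \oo, w k <= e * tm k.
Proof.
move=> e0; have e20 : 0 < e ^+ 2 by rewrite exprn_gt0.
apply: filterS (trel_small e20) => k h.
rewrite -(@ler_pXn2r _ 2)// ?nnegrE ?mulr_ge0 ?(ltW e0)// w2 exprMn.
by rewrite [tm k ^+ 2]expr2 mulrA [leLHS]mulrC ler_wpM2r.
Qed.

(** Absorbs the extra trel of [tmix_diff] for all [k]: the product condition covers all but finitely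
    many chains, and [tmix_ge1] lets a finite sum cover the others. *)
Lemma trel_le_window : exists2 B : R, 0 <= B & forall k, trel (P k) <= B * w k.
Proof.
have [N _ hN] := trel_small ltr01.
pose B := 1 + \sum_(i < N) trel (P i).
have S0 : 0 <= \sum_(i < N) trel (P i) by apply: sumr_ge0.
have B1 : 1 <= B by rewrite lerDl.
have TB k : trel (P k) <= B * tm k.
  have [Nk|kN] := leqP N k.
    by apply: le_trans (hN k Nk) _; rewrite ler_wpM2r.
  apply: (@le_trans _ _ B); last by rewrite ler_peMr// (le_trans ler01).
  rewrite /B (bigD1 (Ordinal kN))//= addrCA lerDl addr_ge0//.
  by apply: sumr_ge0.
have B0 : 0 <= B by exact: le_trans B1.
exists B => // k; rewrite -(@ler_pXn2r _ 2)// ?nnegrE ?mulr_ge0// exprMn w2.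
apply: (@le_trans _ _ (B * (tm k * trel (P k)))).
  by rewrite expr2 mulrA ler_wpM2r.
by rewrite ler_wpM2r ?mulr_ge0// expr2 ler_peMl.
Qed.

Lemma tmix_diff_window a b : 0 < a < 1 -> 0 < b < 1 ->
  exists2 C : R, 0 < C & forall k,
    tmix (P k) (pi k) a - tmix (P k) (pi k) b <= C * w k.
Proof.
move=> a01 b01; have [B B0 hB] := trel_le_window.
set W := window_const delta (Num.truncn r).+1 a b.
exists ((`|W| + 1) * (1 + B)); first by apply: mulr_gt0; [exact: ltr_wpDl | exact: ltr_pwDl].
move=> k; apply: le_trans (tmix_diff d0 (sbd k) a01 b01) _.
rewrite -/W -/(tm k) -/(w k) -mulrA.
apply: (@le_trans _ _ ((`|W| + 1) * (w k + trel (P k)))).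
  rewrite ler_wpM2r ?addr_ge0//; apply: le_trans (ler_norm W) _; by rewrite lerDl.
by rewrite ler_wpM2l ?addr_ge0// mulrDl mul1r lerD2l.
Qed.

Lemma window_littleo : w =o_\oo tm.
Proof.
apply/eqoP => e e0; apply: filterS (window_small e0) => k.
by rewrite (ger0_norm (w0 k)) (ger0_norm (tm0 k)).
Qed.

Lemma tmix_ratio_cvg (eps : R) : 0 < eps < 1 ->
  (fun k => tmix (P k) (pi k) eps / tmix (P k) (pi k) (1 - eps)) @ \oo --> (1 : R).
Proof.
move=> e01; have e01' : 0 < 1 - eps < 1.
  by move: e01 => /andP[? ?]; apply/andP; split; lra.
have q01 : 0 < (4^-1 : R) < 1 by apply/andP; split; lra.
have [C1 C10 h1] := tmix_diff_window e01 e01'.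
have [C2 C20 h2] := tmix_diff_window e01' e01.
have [C3 C30 h3] := tmix_diff_window q01 e01'.
apply/cvgrPdist_le => e e0.
pose C := C1 + C2 + C3; have C0 : 0 < C by rewrite !addr_gt0.
(* Capping [e] at 1 keeps the denominator at least half of [tm k], so an error of (m/2) tm k is at
   most e times the denominator. *)
pose m := Num.min e 1; have m0 : 0 < m by rewrite lt_min e0 ltr01.
have me : m <= e by rewrite ge_min lexx.
have m1 : m <= 1 by rewrite ge_min lexx orbT.
have eta0 : 0 < m / (2 * C) by rewrite divr_gt0 ?mulr_gt0.
apply: filterS (window_small eta0) => k wk.
have Cw : C * w k <= m / 2 * tm k.
  have -> : m / 2 * tm k = C * (m / (2 * C) * tm k) by field; rewrite gt_eqF.
  by rewrite ler_pM2l.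
pose x := tmix (P k) (pi k) eps; pose y := tmix (P k) (pi k) (1 - eps).
rewrite -/x -/y.
have tmk := tm1 k; have wk0 := w0 k.
have d1 : x - y <= C1 * w k := h1 k.
have d2 : y - x <= C2 * w k := h2 k.
have d3 : tm k - y <= C3 * w k := h3 k.
have p1 : 0 <= C1 * w k by rewrite mulr_ge0// ltW.
have p2 : 0 <= C2 * w k by rewrite mulr_ge0// ltW.
have p3 : 0 <= C3 * w k by rewrite mulr_ge0// ltW.
rewrite /C !mulrDl in Cw.
have mt : m * tm k <= tm k by rewrite ler_piMl.
have y0 : 0 < y by lra.
have -> : 1 - x / y = (y - x) / y by rewrite mulrBl divff ?gt_eqF.
rewrite normrM [`|y^-1|]gtr0_norm ?invr_gt0// ler_pdivrMr// ler_norml.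
have ey : m / 2 * tm k <= e * y.
  apply: (@le_trans _ _ (m * y)); last by rewrite ler_wpM2r// ltW.
  by rewrite -mulrA ler_pM2l//; lra.
by apply/andP; split; lra.
Qed.

End Cutoff.

Theorem theorem2 (R : realType) (delta r : R) (n : nat -> nat)
    (P : forall k : nat, 'M[R]_(n k)) (pi : forall k : nat, 'rV[R]_(n k)) :
  0 < delta -> 0 < r ->
  (forall k, SBD_chain delta r (P k) (pi k)) ->
  product_condition P pi ->
  exhibits_cutoff P pi /\
  has_cutoff_window P pi
    (fun k => Num.sqrt (tmix (P k) (pi k) 4^-1 * trel (P k))).
Proof.
move=> d0 _ sbd prod; split; first by move=> eps; exact: (tmix_ratio_cvg d0 sbd prod).
split; first exact: (window_littleo d0 sbd prod).
move=> eps /andP[e0 e1]; apply: (tmix_diff_window d0 sbd prod).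
  by rewrite e0.
by apply/andP; split; lra.
Qed.
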